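(* The following is provable in $\mathrm{BZFC}$: for each cardinal number $\kappa$, there are uniquely determined classical cardinals $\kappa_{\mathbf t}$, $\kappa_{\mathbf b}$, and $\kappa_{\mathbf n}$ such that $$\kappa=\kappa_{\mathbf t}+\kappa_{\mathbf b}\cdot\mathfrak b+\kappa_{\mathbf n}\cdot\mathfrak n.$$
   Context: Logic. The background logic is the four-valued first-order logic BS4 with primitives $\sim,\land,\lor,\rightarrow,\leftrightarrow,\bot,\forall,\exists$. A model has a non-empty domain $M$, the usual interpretations of constants and function symbols, and, for each $n$-ary relation symbol $R$, two independent interpretations $R^+,R^-\subseteq M^n$; $=^+$ is true identity and $=^-$ is a symmetric relation. Truth and falsity are defined simultaneously (a formula may be true, false, both, or neither): an atomic formula is true/false according to $R^+$/$R^-$; $\sim\varphi$ is true iff $\varphi$ is false, and false iff $\varphi$ is true; $\varphi\land\psi$ is true iff both are true, false iff at least one is false; $\lor$ dually; $\varphi\rightarrow\psi$ is true iff ($\varphi$ true implies $\psi$ true), false iff $\varphi$ is true and $\psi$ is false; $\varphi\leftrightarrow\psi$ is true iff ($\varphi$ true iff $\psi$ true), false iff ($\varphi$ true and $\psi$ false) or ($\varphi$ false and $\psi$ true); $\forall$ is true iff all instances are true, false iff some instance is false; $\exists$ is true iff some instance is true, false iff all instances are false; $\bot$ is false and not true. $\Gamma\vDash\varphi$ iff $\varphi$ is true in every model in which all of $\Gamma$ is true. Asserting a formula means asserting that it is true; English ''iff'', ''if/then'', ''and'', ''or'' between formulas concern truth. Abbreviations: $\neg\varphi:=\varphi\rightarrow\bot$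 (true iff $\varphi$ is not true); $!\varphi:=\sim\neg\varphi$ (two-valued, true iff $\varphi$ is true); $?\varphi:=\neg\sim\varphi$ (two-valued, true iff $\varphi$ is not false); $\circ\varphi:=\,!\varphi\leftrightarrow ?\varphi$; $\varphi\Rightarrow\psi:=(\varphi\rightarrow\psi)\land(\sim\psi\rightarrow\sim\varphi)$; $\varphi\Leftrightarrow\psi:=(\varphi\leftrightarrow\psi)\land(\sim\varphi\leftrightarrow\sim\psi)$; $\varphi\,\&\,\psi:=\,\sim(\varphi\rightarrow\sim\psi)$; $\exists x\in A\,\varphi:=\exists x(x\in A\,\&\,\varphi)$; $\forall x\in A\,\varphi:=\forall x(x\in A\rightarrow\varphi)$. A slashed relation symbol is the $\sim$-negation of the relation. Set theory. $\mathrm{BZFC}$ is a BS4-theory in the language $\{\in,=\}$ whose objects are called sets. It includes: Extensionality $\forall A\forall B(A=B\Leftrightarrow\forall x(x\in A\Leftrightarrow x\in B))$; Comprehension $\forall A\exists B\forall x(x\in B\Leftrightarrow x\in A\land\varphi(x))$; ACLA: $\exists A(A^!\not\subseteq A^?)\land\exists A(A^?\not\subseteq A^!)$; Choice: every classical set of non-empty sets has a choice function. Here $A=\{x:\varphi(x)\}$ means $\forall x(x\in A\Leftrightarrow\varphi(x))$; $A\subseteq B:=\forall x(x\in A\Rightarrow x\in B)$; $A$ is classical if $\forall x\,{\circ}(x\in A)$; $A^!:=\{x:{!}(x\in A)\}$ and $A^?:=\{x:{?}(x\in A)\}$. The remaining axioms are suitable analogues of those of $\mathrm{ZFC}$; available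 consequences are: $A^!,A^?$ are (classical) sets; $A\subseteq B\leftrightarrow(A^!\subseteq B^!\land A^?\subseteq B^?)$, $A\not\subseteq B\leftrightarrow A^!\not\subseteq B^?$, $A=B\leftrightarrow(A^!=B^!\land A^?=B^?)$, $A\neq B\leftrightarrow(A^!\not\subseteq B^?\lor B^!\not\subseteq A^?)$; for all classical sets $X,Y$ there is a unique set $\langle X|Y\rangle$ with $\langle X|Y\rangle^!=X$, $\langle X|Y\rangle^?=Y$; ordered pairs (and triples) are encoded so that $(a,b)=(c,d)\Leftrightarrow(a=c\land b=d)$; usual $\mathrm{ZFC}$ set theory (including choice and von Neumann ordinals, which live in the inner $\mathrm{ZFC}$-model of hereditarily classical sets) applies to classical sets, whose elements may be arbitrary sets. For a classical set $X$, $|X|_{Cl}$ is the least von Neumann ordinal in bijection with $X$. Put $A_{\mathbf b}:=A^!\setminus A^?$, $A_{\mathbf t}:=A^!\cap A^?$, $A_{\mathbf n}:=A^?\setminus A^!$, $\mathrm{rlm}(A):=A^!\cup A^?$ (all classical sets). For pairwise disjoint classical $X,Y,Z$, $\langle X|Y|Z\rangle$ is the unique set $A$ with $A_{\mathbf b}=X$, $A_{\mathbf t}=Y$, $A_{\mathbf n}=Z$. $\emptyset=\{x:\bot\}$, and $\{a\}$ is the classical set $\{x:{!}(x=a)\}$. Cardinal numbers. The cardinal number of $A$ is the triple $|A|:=(X,Y,Z)$ with $$X:=\big\langle |A^!|_{Cl}\,\big|\,|A^?|_{Cl}\big\rangle,\quad Y:=\big\langle |A_{\mathbf t}|_{Cl}\,\big|\,|A^?|_{Cl}\big\rangle,\quad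 Z:=\big\langle |A_{\mathbf b}|_{Cl}\,\big|\,|A_{\mathbf n}|_{Cl}\big\rangle.$$ Cardinal numbers are the elements of $\{|x|:x\text{ a set}\}$. A classical cardinal is a cardinal number of the form $|X|$ with $X$ a classical set. Arithmetic: $|A|+|B|:=|A\uplus B|$ and $|A|\cdot|B|:=|A\times B|$, where $A\times B:=\{(x,y):x\in A\land y\in B\}$ (so $(a,b)\in A\times B\Leftrightarrow a\in A\land b\in B$) and $A\uplus B:=\{(x,0):x\in A\}\cup\{(x,1):x\in B\}$ (so $(a,0)\in A\uplus B\Leftrightarrow a\in A$ and $(b,1)\in A\uplus B\Leftrightarrow b\in B$). Finally $\mathfrak b:=|\langle\{\emptyset\}|\emptyset|\emptyset\rangle|$ and $\mathfrak n:=|\langle\emptyset|\emptyset|\{\emptyset\}\rangle|$. *)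

(* Defs.v *)
From mathcomp Require Import all_boot.

Set Implicit Arguments.
Unset Strict Implicit.
Unset Printing Implicit Defensive.

(* ---------- The logic BS4 over the language {∈, =} ---------- *)

Definition var := nat.

Inductive form : Type :=
| fMem (x y : var)
| fEql (x y : var)
| fBot
| fNeg (p : form)
| fAnd (p q : form)
| fOr (p q : form)
| fImp (p q : form)
| fIff (p q : form)
| fAll (x : var) (p : form)
| fExi (x : var) (p : form).

Fixpoint free (v : var) (p : form) : bool :=
  match p with
  | fMem x y | fEql x y => (v == x) || (v == y)
  | fBot => false
  | fNeg p => free v p
  | fAnd p q | fOr p q | fImp p q | fIff p q => free v p || free v q
  | fAll x p | fExi x p => (v != x) && free v p
  end.

(* [eqN] is the falsity extension of equality; its truth extension is the
   identity of [dom]. *)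
Record model : Type := Model {
  dom : Type;
  dom_inhabited : inhabited dom;
  memP : dom -> dom -> Prop;
  memN : dom -> dom -> Prop;
  eqN : dom -> dom -> Prop;
  eqN_sym : forall a b, eqN a b -> eqN b a
}.

Definition upd (D : Type) (s : var -> D) (x : var) (a : D) : var -> D :=
  fun y => if y == x then a else s y.

Fixpoint istrue (M : model) (s : var -> dom M) (p : form) : Prop :=
  match p with
  | fMem x y => memP (s x) (s y)
  | fEql x y => s x = s y
  | fBot => False
  | fNeg p => isfalse s p
  | fAnd p q => istrue s p /\ istrue s q
  | fOr p q => istrue s p \/ istrue s q
  | fImp p q => istrue s p -> istrue s q
  | fIff p q => istrue s p <-> istrue s q
  | fAll x p => forall a, istrue (upd s x a) p
  | fExi x p => exists a, istrue (upd s x a) p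
  end
with isfalse (M : model) (s : var -> dom M) (p : form) : Prop :=
  match p with
  | fMem x y => memN (s x) (s y)
  | fEql x y => eqN (s x) (s y)
  | fBot => True
  | fNeg p => istrue s p
  | fAnd p q => isfalse s p \/ isfalse s q
  | fOr p q => isfalse s p /\ isfalse s q
  | fImp p q => istrue s p /\ isfalse s q
  | fIff p q => (istrue s p /\ isfalse s q) \/ (isfalse s p /\ istrue s q)
  | fAll x p => exists a, isfalse (upd s x a) p
  | fExi x p => forall a, isfalse (upd s x a) p
  end.

(* Free variables (the parameters of schema instances) are read universally. *)
Definition models (M : model) (p : form) : Prop :=
  forall s : var -> dom M, istrue s p.

Definition entails (T : form -> Prop) (p : form) : Prop :=
  forall M : model, (forall q, T q -> models M q) -> models M p.

(* ---------- Writing formulas ---------- *)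

(* A [pform] is a formula awaiting a number [d] such that the names >= d are
   unused.  [pAll] and [pExi] bind the name [d], so bound variables are always
   fresh and nested definitions cannot capture their arguments. *)
Definition pform := nat -> form.

Definition pMem (x y : var) : pform := fun _ => fMem x y.
Definition pEql (x y : var) : pform := fun _ => fEql x y.
Definition pBot : pform := fun _ => fBot.
Definition pNeg (p : pform) : pform := fun d => fNeg (p d).
Definition pAnd (p q : pform) : pform := fun d => fAnd (p d) (q d).
Definition pOr (p q : pform) : pform := fun d => fOr (p d) (q d).
Definition pImp (p q : pform) : pform := fun d => fImp (p d) (q d).
Definition pIff (p q : pform) : pform := fun d => fIff (p d) (q d).
Definition pAll (f : var -> pform) : pform := fun d => fAll d (f d d.+1).
Definition pExi (f : var -> pform) : pform := fun d => fExi d (f d d.+1).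

(* Quantifiers with a prescribed name and embedding of a raw formula, used only
   for the axiom schemas. *)
Definition nAll (x : var) (p : pform) : pform := fun d => fAll x (p d).
Definition nExi (x : var) (p : pform) : pform := fun d => fExi x (p d).
Definition raw (p : form) : pform := fun _ => p.

Definition sentence (p : pform) : form := p 0.

Declare Scope bs4_scope.
Delimit Scope bs4_scope with bs4.
Bind Scope bs4_scope with pform.

Notation "x ∈ y" := (pMem x y) (at level 70, no associativity) : bs4_scope.
Notation "x ≐ y" := (pEql x y) (at level 70, no associativity) : bs4_scope.
Notation "⊥" := pBot : bs4_scope.
Notation "∼ p" := (pNeg p) (at level 75, right associativity) : bs4_scope.
Notation "p ∧ q" := (pAnd p q) (at level 80, right associativity) : bs4_scope.
Notation "p ∨ q" := (pOr p q) (at level 85, right associativity) : bs4_scope.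
Notation "p → q" := (pImp p q) (at level 90, right associativity) : bs4_scope.
Notation "p ↔ q" := (pIff p q) (at level 95, no associativity) : bs4_scope.
Notation "∀ x .. y , p" := (pAll (fun x => .. (pAll (fun y => p%bs4)) ..))
  (at level 200, x binder, y binder, right associativity) : bs4_scope.
Notation "∃ x .. y , p" := (pExi (fun x => .. (pExi (fun y => p%bs4)) ..))
  (at level 200, x binder, y binder, right associativity) : bs4_scope.

Local Open Scope bs4_scope.

Definition neg (p : pform) : pform := p → ⊥.
Definition bang (p : pform) : pform := ∼ neg p.
Definition que (p : pform) : pform := neg (∼ p).
Definition circ (p : pform) : pform := bang p ↔ que p.
Definition simp (p q : pform) : pform := (p → q) ∧ (∼ q → ∼ p).
Definition siff (p q : pform) : pform := (p ↔ q) ∧ (∼ p ↔ ∼ q).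
Definition amp (p q : pform) : pform := ∼ (p → ∼ q).

Notation "¬ p" := (neg p) (at level 75, right associativity) : bs4_scope.
Notation "p ⇒ q" := (simp p q) (at level 90, right associativity) : bs4_scope.
Notation "p ⇔ q" := (siff p q) (at level 95, no associativity) : bs4_scope.
Notation "p ＆ q" := (amp p q) (at level 80, right associativity) : bs4_scope.

Definition all_in (A : var) (f : var -> pform) : pform := ∀ x, x ∈ A → f x.
Definition exi_in (A : var) (f : var -> pform) : pform := ∃ x, x ∈ A ＆ f x.

Notation "∀[ x ∈ A ] p" := (all_in A (fun x => p%bs4))
  (at level 200, x name, A at level 69, p at level 200) : bs4_scope.
Notation "∃[ x ∈ A ] p" := (exi_in A (fun x => p%bs4))
  (at level 200, x name, A at level 69, p at level 200) : bs4_scope.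

(* ---------- Set-theoretic vocabulary ---------- *)

(* Function terms are rendered relationally: [is_t y a b] says y = t(a, b). *)

(* A = {x : f x} *)
Definition is_compr (A : var) (f : var -> pform) : pform := ∀ x, x ∈ A ⇔ f x.

Definition subset (A B : var) : pform := ∀ x, x ∈ A ⇒ x ∈ B.
Definition classical (A : var) : pform := ∀ x, circ (x ∈ A).
Definition nonempty (A : var) : pform := ∃ x, x ∈ A.

(* B = A^!  and  B = A^? *)
Definition is_pos (B A : var) : pform := is_compr B (fun x => bang (x ∈ A)).
Definition is_que (B A : var) : pform := is_compr B (fun x => que (x ∈ A)).

(* B = A^! \ A^?,  B = A^! ∩ A^?,  B = A^? \ A^! *)
Definition is_bpart (B A : var) : pform :=
  is_compr B (fun x => bang (x ∈ A) ∧ ∼ que (x ∈ A)).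
Definition is_tpart (B A : var) : pform :=
  is_compr B (fun x => bang (x ∈ A) ∧ que (x ∈ A)).
Definition is_npart (B A : var) : pform :=
  is_compr B (fun x => que (x ∈ A) ∧ ∼ bang (x ∈ A)).

(* A = ⟨X|Y⟩  and  A = ⟨X|Y|Z⟩ *)
Definition is_bi (A X Y : var) : pform := is_pos X A ∧ is_que Y A.
Definition is_tri (A X Y Z : var) : pform :=
  is_bpart X A ∧ is_tpart Y A ∧ is_npart Z A.

Definition is_empty (A : var) : pform := is_compr A (fun _ => ⊥).
Definition is_sing (A a : var) : pform := is_compr A (fun x => bang (x ≐ a)).
Definition is_upair (A a b : var) : pform :=
  is_compr A (fun x => bang (x ≐ a) ∨ bang (x ≐ b)).

(* Kuratowski pairs do not satisfy (a,b) = (c,d) ⇔ (a = c ∧ b = d) in both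
   polarities, because {a} ≠ {c} holds iff a = c is not true, whereas a ≠ c may
   hold together with a = c, or fail together with it.  We therefore take
     (a, b) := {{{x}} : x ∈ a} ∪ {{∅, {x}} : x ∈ b},
   whose positive and negative extensions are disjoint copies of those of a and
   b; the maps x ↦ {{x}} and x ↦ {∅, {x}} are injective with disjoint ranges. *)
Definition is_tag0 (t x : var) : pform := ∃ s, is_sing s x ∧ is_sing t s.
Definition is_tag1 (t x : var) : pform :=
  ∃ e s, is_empty e ∧ is_sing s x ∧ is_upair t e s.
Definition is_pair (p a b : var) : pform :=
  is_compr p (fun z => (∃ x, bang (is_tag0 z x) ∧ x ∈ a)
                     ∨ (∃ x, bang (is_tag1 z x) ∧ x ∈ b)).
Definition is_triple (p a b c : var) : pform :=
  ∃ q, is_pair q a b ∧ is_pair p q c.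

(* In {(x, y) : f x y}, "z is the pair (x, y)" is made two-valued by [bang], so
   that (a, b) ∈ A × B ⇔ a ∈ A ∧ b ∈ B holds in both polarities even when
   a ≠ a or b ≠ b; likewise for the disjoint union. *)
Definition is_prod (P A B : var) : pform :=
  is_compr P (fun z => ∃ x y, bang (is_pair z x y) ∧ (x ∈ A ∧ y ∈ B)).
Definition is_dsum (S A B : var) : pform :=
  ∃ o i, is_empty o ∧ is_sing i o ∧
    is_compr S (fun z => (∃ x, bang (is_pair z x o) ∧ x ∈ A)
                       ∨ (∃ x, bang (is_pair z x i) ∧ x ∈ B)).

Definition maps_to (f x y : var) : pform := ∃ p, is_pair p x y ∧ p ∈ f.

(* Functions, bijections: f is a classical set, X and Y are meant classical. *)
Definition is_fun_on (f X : var) : pform :=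
  classical f
  ∧ (∀[p ∈ f] ∃[x ∈ X] ∃ y, is_pair p x y)
  ∧ (∀[x ∈ X] ∃ y, ∀ y', maps_to f x y' ↔ y' ≐ y).
Definition is_bij (f X Y : var) : pform :=
  is_fun_on f X
  ∧ (∀[x ∈ X] ∀ y, maps_to f x y → y ∈ Y)
  ∧ (∀[y ∈ Y] ∃ x, ∀ x', maps_to f x' y ↔ x' ≐ x).
Definition equipotent (X Y : var) : pform := ∃ f, is_bij f X Y.

(* Von Neumann ordinals: hereditarily classical transitive sets well-ordered
   by ∈. *)
Definition is_ord (a : var) : pform :=
  classical a
  ∧ (∀[x ∈ a] classical x)
  ∧ (∀[x ∈ a] ∀[y ∈ x] y ∈ a)
  ∧ (∀[x ∈ a] ¬ (x ∈ x))
  ∧ (∀[x ∈ a] ∀[y ∈ a] ∀[z ∈ a] (x ∈ y ∧ y ∈ z → x ∈ z))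
  ∧ (∀[x ∈ a] ∀[y ∈ a] (x ∈ y ∨ x ≐ y ∨ y ∈ x))
  ∧ (∀ z, classical z ∧ subset z a ∧ nonempty z →
       ∃[m ∈ z] ∀[y ∈ z] (m ∈ y ∨ m ≐ y)).

(* a = |X|_Cl *)
Definition is_clcard (a X : var) : pform :=
  classical X ∧ is_ord a ∧ equipotent X a
  ∧ (∀ b, is_ord b ∧ equipotent X b → a ∈ b ∨ a ≐ b).

(* a = |B|_Cl for the set B specified by [f] *)
Definition is_clcard_of (a : var) (f : var -> pform) : pform :=
  ∃ B, f B ∧ is_clcard a B.

(* k = |A| *)
Definition is_card (k A : var) : pform :=
  ∃ cpos cque cb ct cn X Y Z,
    is_clcard_of cpos (fun B => is_pos B A)
    ∧ is_clcard_of cque (fun B => is_que B A)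
    ∧ is_clcard_of cb (fun B => is_bpart B A)
    ∧ is_clcard_of ct (fun B => is_tpart B A)
    ∧ is_clcard_of cn (fun B => is_npart B A)
    ∧ is_bi X cpos cque ∧ is_bi Y ct cque ∧ is_bi Z cb cn
    ∧ is_triple k X Y Z.

Definition cardinal (k : var) : pform := ∃ A, is_card k A.
Definition classical_cardinal (k : var) : pform :=
  ∃ X, classical X ∧ is_card k X.

(* m = k + l  and  m = k · l *)
Definition is_cadd (m k l : var) : pform :=
  ∃ A B S, is_card k A ∧ is_card l B ∧ is_dsum S A B ∧ is_card m S.
Definition is_cmul (m k l : var) : pform :=
  ∃ A B P, is_card k A ∧ is_card l B ∧ is_prod P A B ∧ is_card m P.

Definition is_frak_b (k : var) : pform :=
  ∃ e s A, is_empty e ∧ is_sing s e ∧ is_tri A s e e ∧ is_card k A.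
Definition is_frak_n (k : var) : pform :=
  ∃ e s A, is_empty e ∧ is_sing s e ∧ is_tri A e e s ∧ is_card k A.

(* k = (t + b · 𝔟) + n · 𝔫 *)
Definition is_decomposition (k t b n : var) : pform :=
  ∃ fb fn bb nn tb,
    is_frak_b fb ∧ is_frak_n fn
    ∧ is_cmul bb b fb ∧ is_cmul nn n fn
    ∧ is_cadd tb t bb ∧ is_cadd k tb nn.

(* ---------- The theory BZFC ---------- *)

Definition AxExtensionality : pform :=
  ∀ A B, A ≐ B ⇔ (∀ x, x ∈ A ⇔ x ∈ B).

Definition AxComprehension (A B x : var) (phi : form) : pform :=
  nAll A (nExi B (nAll x (x ∈ B ⇔ x ∈ A ∧ raw phi))).

Definition AxClassicalSuperset : pform :=
  ∀ A, ∃ C, classical C ∧ subset A C.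

(* Pairing, Power Set and Replacement produce classical sets: without [bang]
   the set of x that are not false members may be a proper class, e.g. no set
   satisfies x ∈ B ⇔ x = ∅. *)
Definition AxPairing : pform := ∀ a b, ∃ C, is_upair C a b.

Definition AxUnion : pform :=
  ∀ A, ∃ B, is_compr B (fun x => ∃[y ∈ A] x ∈ y).

Definition AxPowerSet : pform :=
  ∀ A, ∃ B, is_compr B (fun x => bang (subset x A)).

Definition AxInfinity : pform :=
  ∃ A, (∃[e ∈ A] is_empty e)
    ∧ (∀[x ∈ A] ∃[y ∈ A] is_compr y (fun z => z ∈ x ∨ bang (z ≐ x))).

Definition AxReplacement (A B x y z : var) (phi : form) : pform :=
  nAll A
    (nAll x (x ∈ A → nExi z (nAll y (raw phi ↔ y ≐ z))) →
     nExi B (nAll y (y ∈ B ⇔ nExi x (x ∈ A ＆ bang (raw phi))))).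

(* Every non-empty set has a member whose realm it does not meet. *)
Definition AxFoundation : pform :=
  ∀ A, nonempty A →
    ∃[x ∈ A] ∀[y ∈ A] (¬ (y ∈ x) ∧ ¬ que (y ∈ x)).

Definition AxChoice : pform :=
  ∀ A, classical A ∧ (∀[x ∈ A] nonempty x) →
    ∃ f, is_fun_on f A ∧ (∀[x ∈ A] ∃[y ∈ x] maps_to f x y).

Definition AxACLA : pform :=
  (∃ A X Y, is_pos X A ∧ is_que Y A ∧ ∼ subset X Y)
  ∧ (∃ A X Y, is_pos X A ∧ is_que Y A ∧ ∼ subset Y X).

Inductive BZFC : form -> Prop :=
| bzfc_extensionality : BZFC (sentence AxExtensionality)
| bzfc_comprehension (A B x : var) (phi : form) :
    uniq [:: A; B; x] -> ~~ free B phi ->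
    BZFC (sentence (AxComprehension A B x phi))
| bzfc_classical_superset : BZFC (sentence AxClassicalSuperset)
| bzfc_pairing : BZFC (sentence AxPairing)
| bzfc_union : BZFC (sentence AxUnion)
| bzfc_power_set : BZFC (sentence AxPowerSet)
| bzfc_infinity : BZFC (sentence AxInfinity)
| bzfc_replacement (A B x y z : var) (phi : form) :
    uniq [:: A; B; x; y; z] -> ~~ free B phi -> ~~ free z phi ->
    BZFC (sentence (AxReplacement A B x y z phi))
| bzfc_foundation : BZFC (sentence AxFoundation)
| bzfc_choice : BZFC (sentence AxChoice)
| bzfc_acla : BZFC (sentence AxACLA).

(* Main.v *)
(* A set A splits into a glutty part A_b, a classical part A_t and a gappy part
   A_n.  Multiplying a classical cardinal by 𝔟 (resp. 𝔫) turns all its members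
   into gluts (resp. gaps), so |A| = |A_t| + |A_b|·𝔟 + |A_n|·𝔫: the first
   projection maps the disjoint union bijectively onto A, since the three parts
   are disjoint.  Conversely |A| determines the cardinalities of all parts, and
   in any decomposition of |A| the summands can only contribute to A_t, A_b and
   A_n respectively.  Every ordinal needed is already given by |A|, so neither
   choice nor the theory of well-orders is used. *)

(* The argument runs inside an arbitrary model: formulas are replaced by their truth and falsity
   conditions, and a set becomes a pair of independent predicates on the domain. The main obstacle
   is existence. Sums and products are relations that assert that their result has a cardinal
   number, and a cardinal number packs five ordinals, so all five must be found for every
   intermediate set. The sets are chosen so that each part is empty, a single point, or equinumerous
   with a part of A; then the ordinals are 0, 1 or components of |A|. For uniqueness, the
   representatives hidden in sums and products are arbitrary. What survives a change of
   representative is purity: membership of one kind only (glutty, classical or gappy). ACLA enters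
   solely through one glut and one gap, used as parameters to build sets whose positive and negative
   extensions are prescribed separately. *)
From Stdlib Require Import Classical ClassicalEpsilon FunctionalExtensionality PropExtensionality.
From mathcomp Require Import all_boot.
Require Import Defs.

Set Implicit Arguments.
Unset Strict Implicit.
Unset Printing Implicit Defensive.

(* The hints compute truth and falsity conditions: they solve goals
   [istrue s (p d) <-> Q] and [isfalse s (p d) <-> Q] by following the syntax of
   [p].  Constants are opaque so that each defined notion is interpreted by its
   own lemma. *)
Create HintDb sem discriminated.
#[global] Hint Constants Opaque : sem.
#[global] Hint Variables Opaque : sem.
#[global] Hint Transparent var : sem.

Ltac sem := solve [typeclasses eauto with sem].

(** * Truth conditions *)

Section Semantics.

Variable M : model.
Local Notation D := (dom M).
Local Notation E := (@memP M).
Local Notation N := (@memN M).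
Implicit Types (s : var -> D) (d : nat) (f : var -> pform).

(* The name x is in scope at level d (hence differs from all names that [pAll]
   and [pExi] will bind) and denotes a. *)
Definition den s d (x : var) (a : D) : Prop := x < d /\ s x = a.

Lemma den_here s d a : den (upd s d a) d.+1 d a.
Proof. by split=> //; rewrite /upd eqxx. Qed.

Lemma den_upd s d x a b : den s d x a -> den (upd s d b) d.+1 x a.
Proof. by case=> lt_xd <-; split; [exact: ltnW | rewrite /upd ltn_eqF]. Qed.

Lemma iT_mem s d d' x y a b :
  den s d x a -> den s d y b -> istrue s (pMem x y d') <-> E a b.
Proof. by case=> _ <- [_ <-]. Qed.

Lemma iF_mem s d d' x y a b :
  den s d x a -> den s d y b -> isfalse s (pMem x y d') <-> N a b.
Proof. by case=> _ <- [_ <-]. Qed.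

Lemma iT_eql s d d' x y a b :
  den s d x a -> den s d y b -> istrue s (pEql x y d') <-> a = b.
Proof. by case=> _ <- [_ <-]. Qed.

(** The form [~ False] lets unification match the falsity condition [~ P x] of classical sets when
    [is_empty] is interpreted. *)
Lemma iF_bot s d : isfalse s (pBot d) <-> ~ False.
Proof. by rewrite /=; tauto. Qed.

Lemma iT_bot s d : istrue s (pBot d) <-> False.
Proof. by rewrite /=; tauto. Qed.

Lemma iT_and s d (p q : pform) P Q :
  istrue s (p d) <-> P -> istrue s (q d) <-> Q ->
  istrue s (pAnd p q d) <-> P /\ Q.
Proof. move=> *; rewrite /=; tauto. Qed.

Lemma iF_and s d (p q : pform) P Q :
  isfalse s (p d) <-> P -> isfalse s (q d) <-> Q ->
  isfalse s (pAnd p q d) <-> P \/ Q.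
Proof. move=> *; rewrite /=; tauto. Qed.

Lemma iT_or s d (p q : pform) P Q :
  istrue s (p d) <-> P -> istrue s (q d) <-> Q ->
  istrue s (pOr p q d) <-> P \/ Q.
Proof. move=> *; rewrite /=; tauto. Qed.

Lemma iF_or s d (p q : pform) P Q :
  isfalse s (p d) <-> P -> isfalse s (q d) <-> Q ->
  isfalse s (pOr p q d) <-> P /\ Q.
Proof. move=> *; rewrite /=; tauto. Qed.

Lemma iT_imp s d (p q : pform) P Q :
  istrue s (p d) <-> P -> istrue s (q d) <-> Q ->
  istrue s (pImp p q d) <-> (P -> Q).
Proof. move=> *; rewrite /=; tauto. Qed.

Lemma iT_iff s d (p q : pform) P Q :
  istrue s (p d) <-> P -> istrue s (q d) <-> Q ->
  istrue s (pIff p q d) <-> (P <-> Q).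
Proof. move=> *; rewrite /=; tauto. Qed.

Lemma iT_neg s d (p : pform) P : istrue s (p d) <-> P -> istrue s (neg p d) <-> ~ P.
Proof. move=> *; rewrite /=; tauto. Qed.

Lemma iT_bang s d (p : pform) P : istrue s (p d) <-> P -> istrue s (bang p d) <-> P.
Proof. move=> *; rewrite /=; tauto. Qed.

Lemma iF_bang s d (p : pform) P : istrue s (p d) <-> P -> isfalse s (bang p d) <-> ~ P.
Proof. move=> *; rewrite /=; tauto. Qed.

Lemma iT_que s d (p : pform) P : isfalse s (p d) <-> P -> istrue s (que p d) <-> ~ P.
Proof. move=> *; rewrite /=; tauto. Qed.

Lemma iF_que s d (p : pform) P : isfalse s (p d) <-> P -> isfalse s (que p d) <-> P.
Proof. move=> *; rewrite /=; tauto. Qed.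

Lemma iT_pneg s d (p : pform) P : isfalse s (p d) <-> P -> istrue s (pNeg p d) <-> P.
Proof. by []. Qed.

Lemma iF_pneg s d (p : pform) P : istrue s (p d) <-> P -> isfalse s (pNeg p d) <-> P.
Proof. by []. Qed.

Lemma iT_amp s d (p q : pform) P Q :
  istrue s (p d) <-> P -> istrue s (q d) <-> Q ->
  istrue s (amp p q d) <-> P /\ Q.
Proof. move=> *; rewrite /=; tauto. Qed.

Lemma iT_all s d f (P : D -> Prop) :
  (forall a, istrue (upd s d a) (f d d.+1) <-> P a) ->
  istrue s (pAll f d) <-> (forall a, P a).
Proof. by move=> H; split=> h a; apply/H; apply: h. Qed.

Lemma iT_exi s d f (P : D -> Prop) :
  (forall a, istrue (upd s d a) (f d d.+1) <-> P a) ->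
  istrue s (pExi f d) <-> (exists a, P a).
Proof. by move=> H; split=> -[a h]; exists a; apply/H. Qed.

Lemma iF_exi s d f (P : D -> Prop) :
  (forall a, isfalse (upd s d a) (f d d.+1) <-> P a) ->
  isfalse s (pExi f d) <-> (forall a, P a).
Proof. by move=> H; split=> h a; apply/H; apply: h. Qed.

Lemma iF_all s d f (P : D -> Prop) :
  (forall a, isfalse (upd s d a) (f d d.+1) <-> P a) ->
  isfalse s (pAll f d) <-> (exists a, P a).
Proof. by move=> H; split=> -[a h]; exists a; apply/H. Qed.

Lemma iF_imp s d (p q : pform) P Q :
  istrue s (p d) <-> P -> isfalse s (q d) <-> Q ->
  isfalse s (pImp p q d) <-> P /\ Q.
Proof. move=> *; rewrite /=; tauto. Qed.

Lemma iT_all_in s d x f a (P : D -> Prop) :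
  den s d x a -> (forall a, istrue (upd s d a) (f d d.+1) <-> P a) ->
  istrue s (all_in x f d) <-> (forall b, E b a -> P b).
Proof.
move=> dx H; apply: iT_all => b; apply: iT_imp => //.
exact: iT_mem (den_here _ _ _) (den_upd _ dx).
Qed.

Lemma iT_exi_in s d x f a (P : D -> Prop) :
  den s d x a -> (forall a, istrue (upd s d a) (f d d.+1) <-> P a) ->
  istrue s (exi_in x f d) <-> (exists b, E b a /\ P b).
Proof.
move=> dx H; apply: iT_exi => b; apply: iT_amp => //.
exact: iT_mem (den_here _ _ _) (den_upd _ dx).
Qed.

(** [p ＆ q] is false exactly when truth of [p] implies falsity of [q], so only the true members of
    the bounding set matter. *)
Lemma iF_exi_in s d x f a (P : D -> Prop) :
  den s d x a -> (forall a, isfalse (upd s d a) (f d d.+1) <-> P a) ->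
  isfalse s (exi_in x f d) <-> (forall b, E b a -> P b).
Proof.
move=> dx H; apply: iF_exi => b.
have hE := iT_mem d.+1 (den_here s d b) (den_upd b dx).
by split=> h ?; apply/H; apply: h; apply/hE.
Qed.

(** [T] and [F] are independent: members may be gluts or gaps. *)
Definition setof (A : D) (T F : D -> Prop) : Prop :=
  forall x, (E x A <-> T x) /\ (N x A <-> F x).

Lemma iT_is_compr s d x f A (T F : D -> Prop) :
  (forall a, istrue (upd s d a) (f d d.+1) <-> T a) ->
  (forall a, isfalse (upd s d a) (f d d.+1) <-> F a) ->
  den s d x A ->
  istrue s (is_compr x f d) <-> setof A T F.
Proof.
move=> HT HF dx; apply: iT_all => b; apply: iT_and; apply: iT_iff.
- exact: iT_mem (den_here _ _ _) (den_upd _ dx).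
- exact: HT.
- apply: iT_pneg; exact: iF_mem (den_here _ _ _) (den_upd _ dx).
- exact: HF.
Qed.

Hint Resolve den_here den_upd iT_mem iF_mem iT_eql iF_bot iT_bot iT_and iF_and
  iT_or iF_or iT_imp iF_imp iT_iff iT_neg iT_bang iF_bang iT_que iF_que iT_pneg
  iF_pneg iT_amp iT_all iF_all iT_exi iF_exi iT_all_in iT_exi_in iF_exi_in
  iT_is_compr : sem.

Definition ext (A : D) (P : D -> Prop) : Prop := setof A P (fun x => ~ P x).

Lemma setofT A (T F : D -> Prop) x : setof A T F -> E x A <-> T x.
Proof. by move=> /(_ x) []. Qed.

Lemma setofF A (T F : D -> Prop) x : setof A T F -> N x A <-> F x.
Proof. by move=> /(_ x) []. Qed.

Lemma extT A (P : D -> Prop) x : ext A P -> E x A <-> P x.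
Proof. exact: setofT. Qed.

Lemma extF A (P : D -> Prop) x : ext A P -> N x A <-> ~ P x.
Proof. exact: setofF. Qed.

Lemma iT_ext s d x f A (P : D -> Prop) :
  (forall a, istrue (upd s d a) (f d d.+1) <-> P a) ->
  (forall a, isfalse (upd s d a) (f d d.+1) <-> ~ P a) ->
  den s d x A ->
  istrue s (is_compr x f d) <-> ext A P.
Proof. exact: iT_is_compr. Qed.

Hint Resolve iT_ext : sem.

Lemma iT_is_sing s d x y A a :
  den s d x A -> den s d y a -> istrue s (is_sing x y d) <-> ext A (eq^~ a).
Proof. by move=> dx dy; rewrite /is_sing; sem. Qed.

Lemma iT_is_empty s d x A :
  den s d x A -> istrue s (is_empty x d) <-> ext A (fun=> False).
Proof. by move=> dx; rewrite /is_empty; sem. Qed.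

Lemma iT_is_upair s d x y z A a b :
  den s d x A -> den s d y a -> den s d z b ->
  istrue s (is_upair x y z d) <->
  setof A (fun c => c = a \/ c = b) (fun c => c <> a /\ c <> b).
Proof. by move=> dx dy dz; rewrite /is_upair; sem. Qed.

Hint Resolve iT_is_sing iT_is_empty iT_is_upair : sem.

Inductive part := Pos | Que | Bp | Tp | Np.

(* The classical value of a part of A at x, given the truth value e and the
   falsity value n of the formula x ∈ A. *)
Definition pval (i : part) (e n : Prop) : Prop :=
  match i with
  | Pos => e
  | Que => ~ n
  | Bp => e /\ n
  | Tp => e /\ ~ n
  | Np => ~ n /\ ~ e
  end.

Definition psat (i : part) (A x : D) : Prop := pval i (E x A) (N x A).

Definition is_part (i : part) : var -> var -> pform :=
  match i with
  | Pos => is_pos | Que => is_que | Bp => is_bpart | Tp => is_tpart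
  | Np => is_npart
  end.

Lemma iT_is_part i s d x y B A :
  den s d x B -> den s d y A ->
  istrue s (is_part i x y d) <-> ext B (psat i A).
Proof.
move=> dx dy; case: i; apply: iT_ext dx => z; cbv [psat pval]; try sem.
(* What remains are falsity conditions. Their compositional form, read off by [sem], is the negation
   of the truth condition only by classical logic. *)
- apply: (iff_trans (B := N z A)); first sem.
  by case: (classic (N z A)); tauto.
- apply: (iff_trans (B := ~ E z A \/ ~ N z A)); first sem.
  by case: (classic (E z A)); case: (classic (N z A)); tauto.
- apply: (iff_trans (B := ~ E z A \/ N z A)); first sem.
  by case: (classic (E z A)); case: (classic (N z A)); tauto.
- apply: (iff_trans (B := N z A \/ E z A)); first sem.
  by case: (classic (E z A)); case: (classic (N z A)); tauto.
Qed.

Lemma iT_is_pos s d x y B A : den s d x B -> den s d y A ->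
  istrue s (is_pos x y d) <-> ext B (psat Pos A).
Proof. exact: (iT_is_part Pos). Qed.

Lemma iT_is_que s d x y B A : den s d x B -> den s d y A ->
  istrue s (is_que x y d) <-> ext B (psat Que A).
Proof. exact: (iT_is_part Que). Qed.

Lemma iT_is_bpart s d x y B A : den s d x B -> den s d y A ->
  istrue s (is_bpart x y d) <-> ext B (psat Bp A).
Proof. exact: (iT_is_part Bp). Qed.

Lemma iT_is_tpart s d x y B A : den s d x B -> den s d y A ->
  istrue s (is_tpart x y d) <-> ext B (psat Tp A).
Proof. exact: (iT_is_part Tp). Qed.

Lemma iT_is_npart s d x y B A : den s d x B -> den s d y A ->
  istrue s (is_npart x y d) <-> ext B (psat Np A).
Proof. exact: (iT_is_part Np). Qed.

Hint Resolve iT_is_pos iT_is_que iT_is_bpart iT_is_tpart iT_is_npart : sem.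

Definition Bi (A X Y : D) : Prop := ext X (psat Pos A) /\ ext Y (psat Que A).

Lemma iT_is_bi s d x y z A X Y :
  den s d x A -> den s d y X -> den s d z Y ->
  istrue s (is_bi x y z d) <-> Bi A X Y.
Proof. by move=> *; rewrite /is_bi /Bi; sem. Qed.

Definition Tri (A X Y Z : D) : Prop :=
  ext X (psat Bp A) /\ ext Y (psat Tp A) /\ ext Z (psat Np A).

Lemma iT_is_tri s d x y z w A X Y Z :
  den s d x A -> den s d y X -> den s d z Y -> den s d w Z ->
  istrue s (is_tri x y z w d) <-> Tri A X Y Z.
Proof. by move=> *; rewrite /is_tri /Tri; sem. Qed.

Definition Cls (A : D) : Prop := forall x, E x A <-> ~ N x A.

Lemma iT_classical s d x A :
  den s d x A -> istrue s (classical x d) <-> Cls A.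
Proof. by move=> *; rewrite /classical /circ /Cls; sem. Qed.

Definition Sub (A B : D) : Prop :=
  forall x, (E x A -> E x B) /\ (N x B -> N x A).

Lemma iT_subset s d x y A B :
  den s d x A -> den s d y B -> istrue s (subset x y d) <-> Sub A B.
Proof. by move=> *; rewrite /subset /simp /Sub; sem. Qed.

Lemma iT_nonempty s d x A :
  den s d x A -> istrue s (nonempty x d) <-> exists a, E a A.
Proof. by move=> *; rewrite /nonempty; sem. Qed.

Hint Resolve iT_is_bi iT_is_tri iT_classical iT_subset iT_nonempty : sem.

Definition Tag0 (t x : D) : Prop :=
  exists u, ext u (eq^~ x) /\ ext t (eq^~ u).

Lemma iT_is_tag0 s d x y t a :
  den s d x t -> den s d y a -> istrue s (is_tag0 x y d) <-> Tag0 t a.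
Proof. by move=> *; rewrite /is_tag0 /Tag0; sem. Qed.

Definition Tag1 (t x : D) : Prop :=
  exists e u, ext e (fun=> False) /\ ext u (eq^~ x) /\
    setof t (fun c => c = e \/ c = u) (fun c => c <> e /\ c <> u).

Lemma iT_is_tag1 s d x y t a :
  den s d x t -> den s d y a -> istrue s (is_tag1 x y d) <-> Tag1 t a.
Proof. by move=> *; rewrite /is_tag1 /Tag1; sem. Qed.

Hint Resolve iT_is_tag0 iT_is_tag1 : sem.

Definition Pair p a b : Prop :=
  setof p
    (fun z => (exists x, Tag0 z x /\ E x a) \/ (exists x, Tag1 z x /\ E x b))
    (fun z => (forall x, ~ Tag0 z x \/ N x a) /\
              (forall x, ~ Tag1 z x \/ N x b)).

Lemma iT_is_pair s d x y z p a b :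
  den s d x p -> den s d y a -> den s d z b ->
  istrue s (is_pair x y z d) <-> Pair p a b.
Proof. by move=> *; rewrite /is_pair /Pair; sem. Qed.

Definition Ord (a : D) : Prop :=
  Cls a
  /\ (forall x, E x a -> Cls x)
  /\ (forall x, E x a -> forall y, E y x -> E y a)
  /\ (forall x, E x a -> ~ E x x)
  /\ (forall x, E x a -> forall y, E y a -> forall z, E z a ->
         E x y /\ E y z -> E x z)
  /\ (forall x, E x a -> forall y, E y a -> E x y \/ x = y \/ E y x)
  /\ (forall z, Cls z /\ Sub z a /\ (exists x, E x z) ->
         exists m, E m z /\ forall y, E y z -> E m y \/ m = y).

Lemma iT_is_ord s d x a : den s d x a -> istrue s (is_ord x d) <-> Ord a.
Proof. by move=> *; rewrite /is_ord /Ord; sem. Qed.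

Hint Resolve iT_is_ord : sem.

(** * Sets, pairs and bijections in a model of BZFC *)

Implicit Types (P Q : D -> Prop).

Hypothesis MT : forall phi, BZFC phi -> models M phi.

(** [Q] is the reading of an axiom under every valuation; the single valuation that is used comes
    from non-emptiness of the domain. *)
Lemma axE phi (Q : Prop) :
  BZFC phi -> (forall s, istrue s phi <-> Q) -> Q.
Proof. by case: (dom_inhabited M) => a /MT Hphi /(_ (fun=> a)) <-. Qed.

Lemma ax_ext (A B : D) :
  (forall x, (E x A <-> E x B) /\ (N x A <-> N x B)) -> A = B.
Proof. exact: proj2 (proj1 (MT bzfc_extensionality (fun=> A) A B)). Qed.

Lemma setof_uniq A B (T F : D -> Prop) : setof A T F -> setof B T F -> A = B.
Proof. by move=> hA hB; apply: ax_ext => x; move: (hA x) (hB x); tauto. Qed.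

Lemma ext_uniq A B (P : D -> Prop) : ext A P -> ext B P -> A = B.
Proof. exact: setof_uniq. Qed.

Lemma ext_cls A (P : D -> Prop) : ext A P -> Cls A.
Proof.
by move=> hA x; move: (hA x); case: (classic (P x)); tauto.
Qed.

Lemma cls_ext A : Cls A -> ext A (E^~ A).
Proof. by move=> hA x; move: (hA x); case: (classic (N x A)); tauto. Qed.

(* Separation instances bind 0 (the element), 1 and 2 (the two sets). *)
Definition def1 (T F : D -> Prop) : Prop :=
  exists phi s, ~~ free 2 phi /\
    forall s', (forall n, 2 < n -> s' n = s n) ->
      (istrue s' phi <-> T (s' 0)) /\ (isfalse s' phi <-> F (s' 0)).

(** Names 3 to 8 carry the parameters, and level 9 keeps the bound names of [p] clear of them. The
    values listed for 0, 1 and 2 are placeholders, since the instance binds these names. *)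
Lemma def1I (p : pform) (a b c d e f : D) (T F : D -> Prop) :
  ~~ free 2 (p 9) ->
  (forall s x, den s 9 0 x -> den s 9 3 a -> den s 9 4 b -> den s 9 5 c ->
     den s 9 6 d -> den s 9 7 e -> den s 9 8 f ->
     (istrue s (p 9) <-> T x) /\ (isfalse s (p 9) <-> F x)) ->
  def1 T F.
Proof.
move=> fr H; exists (p 9), (nth a [:: a; a; a; a; b; c; d; e; f]); split=> //.
by move=> s' es; apply: H; split=> //; rewrite es.
Qed.

(* Replacement instances bind 0 (argument), 1 (value), 2, 3 and 4. *)
Definition def2 (R : D -> D -> Prop) : Prop :=
  exists phi s, [/\ ~~ free 2 phi, ~~ free 4 phi &
    forall s', (forall n, 4 < n -> s' n = s n) ->
      (istrue s' phi <-> R (s' 0) (s' 1))].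

(** As for separation, but the instance binds 0 to 4, which leaves 5 to 8 for parameters. *)
Lemma def2I (p : pform) (a b c d : D) (R : D -> D -> Prop) :
  ~~ free 2 (p 9) -> ~~ free 4 (p 9) ->
  (forall s x y, den s 9 0 x -> den s 9 1 y -> den s 9 5 a -> den s 9 6 b ->
     den s 9 7 c -> den s 9 8 d -> istrue s (p 9) <-> R x y) ->
  def2 R.
Proof.
move=> fr fr' H.
exists (p 9), (nth a [:: a; a; a; a; a; a; b; c; d]); split=> //.
by move=> s' es; apply: H; split=> //; rewrite es.
Qed.

(** * Classical bounds, Separation and Replacement *)

Definition small (P : D -> Prop) : Prop :=
  exists C, Cls C /\ forall x, P x -> E x C.

Definition isset (P : D -> Prop) : Prop := exists X, ext X P.

(** Comprehension cuts the set out of a classical C, and outside C membership is false and not true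
    whatever the formula says. Hence the bound has to cover the points where [T] holds and also
    those where [F] fails. *)
Lemma mkset (T F : D -> Prop) :
  small (fun x => T x \/ ~ F x) -> def1 T F -> exists A, setof A T F.
Proof.
case=> C [clC hC] [phi [s [fr H]]].
have [B hB] := MT (@bzfc_comprehension 1 2 0 phi isT fr) s C.
exists B => x; have [hT hF] := hB x.
set s' := upd (upd (upd s 1 C) 2 B) 0 x in hT hF.
have es n : 2 < n -> s' n = s n by case: n => [|[|[|n]]].
have [HT HF] := H s' es; rewrite /= in hT hF.
change (s' 0) with x in HT, HF; change (s' 2) with B in hT, hF.
change (s' 1) with C in hT, hF.
move: hT hF (hC x) (clC x); case: (classic (F x)); tauto.
Qed.

Lemma isset_small (P : D -> Prop) : isset P -> small P.
Proof.
case=> X hX; exists X; split; first exact: ext_cls hX.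
by move=> x Px; apply/(extT _ hX).
Qed.

Lemma small_sub (P Q : D -> Prop) :
  (forall x, P x -> Q x) -> small Q -> small P.
Proof. by move=> PQ [C [clC hC]]; exists C; split=> // x /PQ/hC. Qed.

Lemma isset_sep (P : D -> Prop) :
  small P -> def1 P (fun x => ~ P x) -> isset P.
Proof.
move=> sP dP; apply: mkset => //; apply: small_sub sP => x.
by case: (classic (P x)); tauto.
Qed.

(** Inclusion in the classical superset also contraposes falsity, so the superset contains the gaps
    of A and not only its true members. *)
Lemma small_realm A : small (fun x => E x A \/ ~ N x A).
Proof.
have [C [clC subC]] : exists C, Cls C /\ Sub A C.
  move: A; apply: (axE bzfc_classical_superset) => s.
  by rewrite /sentence /AxClassicalSuperset; sem.
exists C; split=> // x; move: (clC x) (subC x).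
by case: (classic (N x C)); tauto.
Qed.

Lemma upair_ex a b :
  exists A, setof A (fun c => c = a \/ c = b) (fun c => c <> a /\ c <> b).
Proof.
move: a b; apply: (axE bzfc_pairing) => s.
by rewrite /sentence /AxPairing; sem.
Qed.

Lemma sing_isset a : isset (eq^~ a).
Proof.
have [A hA] := upair_ex a a; exists A => x; move: (hA x).
by case: (classic (x = a)); tauto.
Qed.

Lemma union_ex A :
  exists B, setof B (fun x => exists y, E y A /\ E x y)
                    (fun x => forall y, E y A -> N x y).
Proof.
move: A; apply: (axE bzfc_union) => s.
by rewrite /sentence /AxUnion; sem.
Qed.

Lemma small_or (P Q : D -> Prop) :
  small P -> small Q -> small (fun x => P x \/ Q x).
Proof.
case=> [A [clA hA]] [B [clB hB]].
have [C hC] := upair_ex A B; have [U hU] := union_ex C.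
exists U; split=> [x | x [/hA ? | /hB ?]]; last first.
- by apply/(setofT _ hU); exists B; split=> //; apply/(setofT _ hC); right.
- by apply/(setofT _ hU); exists A; split=> //; apply/(setofT _ hC); left.
rewrite (setofT _ hU) (setofF _ hU); split=> [[y [/(setofT _ hC) yC Exy]] h | h].
  have {h} := h y; rewrite (setofT _ hC) => /(_ yC) Nxy.
  by move: (clA x) (clB x); case: yC Exy Nxy => ->; tauto.
apply: NNPP => h'; apply: h => y /(setofT _ hC) yC; apply: NNPP => Nxy; apply: h'.
exists y; rewrite (setofT _ hC); split=> //.
by case: yC Nxy => ->; [move/clA | move/clB].
Qed.

Lemma repl (P : D -> Prop) (R : D -> D -> Prop) :
  isset P -> def2 R ->
  (forall x, P x -> exists z, forall y, R x y <-> y = z) ->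
  isset (fun y => exists x, P x /\ R x y).
Proof.
case=> X hX [phi [s [fr2 fr4 H]]] hR.
(* This is the axiom with its truth condition computed. The set is named 3, its image 4, argument
   and value 0 and 1, and the unique value 2. The conjunct [True] is the falsity of [⊥] inside
   [bang]. *)
have ax : (forall x, E x X -> exists z, forall y,
      istrue (upd (upd (upd (upd s 3 X) 0 x) 2 z) 1 y) phi <-> y = z) ->
    exists B, forall y,
      let t x := upd (upd (upd (upd s 3 X) 4 B) 1 y) 0 x in
      (E y B <-> exists x, E x X /\ (istrue (t x) phi /\ True)) /\
      (N y B <-> forall x, E x X -> istrue (t x) phi -> False).
  exact: MT (@bzfc_replacement 3 4 0 1 2 phi isT fr4 fr2) s X.
have [x /(extT _ hX) Px | B hB] := ax.
  have [z hz] := hR x Px; exists z => y.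
  by rewrite -hz; apply: H; case=> [|[|[|[|[|n]]]]].
have {H} Ht y x : istrue (upd (upd (upd (upd s 3 X) 4 B) 1 y) 0 x) phi <-> R x y.
  by apply: H; case=> [|[|[|[|[|n]]]]].
exists B => y; case: (hB y) => /= -> ->; split; split.
- by move=> [x [/(extT _ hX) Px [/Ht Rxy _]]]; exists x.
- by move=> [x [/(extT _ hX) Px /Ht Rxy]]; exists x.
- by move=> h [x [/(extT _ hX) Px /Ht Rxy]]; apply: h Px Rxy.
- by move=> h x /(extT _ hX) Px /Ht Rxy; apply: h; exists x.
Qed.

Lemma small_image (P : D -> Prop) (R : D -> D -> Prop) :
  small P -> def2 R -> (forall x, exists z, forall y, R x y <-> y = z) ->
  small (fun y => exists x, P x /\ R x y).
Proof.
move=> [C [clC hC]] dR hR.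
have : isset (fun y => exists x, E x C /\ R x y).
  by apply: repl => //; exists C; apply: cls_ext.
by move/isset_small; apply: small_sub => y [x [/hC]]; exists x.
Qed.

(** * The empty set, singletons, tags and ordered pairs *)

Lemma isset0 : isset (fun=> False).
Proof.
case: (dom_inhabited M) => a; apply: isset_sep.
  by apply: small_sub (small_realm a).
apply: (@def1I pBot a a a a a a) => // s x *; split; sem.
Qed.

Definition emp : D :=
  epsilon (dom_inhabited M) (fun e => ext e (fun=> False)).
Definition sg (a : D) : D := epsilon (inhabits a) (fun e => ext e (eq^~ a)).

Lemma ext_emp : ext emp (fun=> False).
Proof. exact: epsilon_spec isset0. Qed.

Lemma ext_sg a : ext (sg a) (eq^~ a).
Proof. exact: epsilon_spec (sing_isset a). Qed.

Lemma sg_inj a b : sg a = sg b -> a = b.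
Proof. by move=> e; apply/(extT _ (ext_sg b)); rewrite -e; apply/(extT _ (ext_sg a)). Qed.

Lemma sg_neq0 a : sg a <> emp.
Proof. by move=> e; apply/(extT a ext_emp); rewrite -e; apply/(extT _ (ext_sg a)). Qed.

Lemma Tag0E t x : Tag0 t x <-> t = sg (sg x).
Proof.
split=> [[u [hu ht]] | ->]; last by exists (sg x); split; apply: ext_sg.
rewrite -(ext_uniq hu (ext_sg x)); exact: ext_uniq ht (ext_sg u).
Qed.

Lemma Tag1E t x :
  Tag1 t x <->
  setof t (fun c => c = emp \/ c = sg x) (fun c => c <> emp /\ c <> sg x).
Proof.
split=> [[e [u [he [hu ht]]]] | ht].
  by rewrite -(ext_uniq he ext_emp) -(ext_uniq hu (ext_sg x)).
by exists emp, (sg x); split; [exact: ext_emp | split=> //; exact: ext_sg].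
Qed.

Lemma Tag1_fun x : exists t, forall t', Tag1 t' x <-> t' = t.
Proof.
have [t ht] := upair_ex emp (sg x); exists t => t'; rewrite Tag1E.
by split=> [ht' | -> //]; apply: setof_uniq ht' ht.
Qed.

Lemma Tag1_inj t x y : Tag1 t x -> Tag1 t y -> x = y.
Proof.
rewrite !Tag1E => hx hy.
have : E (sg x) t by apply/(setofT _ hx); right.
by move/(setofT _ hy) => [/sg_neq0 | /sg_inj].
Qed.

Lemma Tag0_inj t x y : Tag0 t x -> Tag0 t y -> x = y.
Proof. by rewrite !Tag0E => -> /sg_inj/sg_inj. Qed.

Lemma Tag01 t x y : Tag0 t x -> ~ Tag1 t y.
Proof.
rewrite Tag0E Tag1E => -> h; have /(extT _ (ext_sg _)) : E emp (sg (sg x)).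
  by apply/(setofT _ h); left.
by move/esym/sg_neq0.
Qed.

(** The bound consists of the images of the realms of [a] and [b] under the two tag maps. Realms are
    used because a gap of a component has to become a gap of the pair. *)
Lemma Pair_ex a b : exists p, Pair p a b.
Proof.
apply: mkset; last first.
  apply: (@def1I (fun d => ((∃ x, bang (is_tag0 0 x) ∧ x ∈ 3)
     ∨ (∃ x, bang (is_tag1 0 x) ∧ x ∈ 4))%bs4 d) a b a a a a) => //.
  by move=> s x *; split; sem.
have im c (R : D -> D -> Prop) : def2 (fun x y => R y x) ->
    (forall x, exists t, forall t', R t' x <-> t' = t) ->
    small (fun z => exists x, (E x c \/ ~ N x c) /\ R z x).
  by move=> dR hR; apply: small_image => //; apply: small_realm.
have d0 : def2 (fun x y => Tag0 y x).
  by apply: (@def2I (is_tag0 1 0) a a a a) => // s x y *; sem.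
have d1 : def2 (fun x y => Tag1 y x).
  by apply: (@def2I (is_tag1 1 0) a a a a) => // s x y *; sem.
have f0 x : exists t, forall t', Tag0 t' x <-> t' = t.
  by exists (sg (sg x)) => t'; apply: Tag0E.
apply: small_sub (small_or (im a _ d0 f0) (im b _ d1 Tag1_fun)) => z.
case=> [[[x [zx xa]] | [x [zx xb]]] | /not_and_or [] h].
- by left; exists x; split; [left |].
- by right; exists x; split; [left |].
- have [x /not_or_and [/NNPP zx xa]] := not_all_ex_not _ _ h.
  by left; exists x; split; [right |].
- have [x /not_or_and [/NNPP zx xa]] := not_all_ex_not _ _ h.
  by right; exists x; split; [right |].
Qed.

Lemma Pair_uniq p q a b : Pair p a b -> Pair q a b -> p = q.
Proof. exact: setof_uniq. Qed.

Lemma Pair_inj p a b a' b' :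
  Pair p a b -> Pair p a' b' -> a = a' /\ b = b'.
Proof.
(* Injectivity and disjointness of the tags let [P0] and [P1] recover both truth and falsity of
   membership in a component, so Extensionality identifies the components. *)
have P0 c e t x : Pair p c e -> Tag0 t x ->
    (E t p <-> E x c) /\ (N t p <-> N x c).
  move=> hp tx; rewrite (setofT _ hp) (setofF _ hp); split; split.
  - by case=> -[y [ty]]; [rewrite (Tag0_inj tx ty) | case: (Tag01 tx ty)].
  - by move=> xc; left; exists x.
  - by case=> /(_ x) [].
  - move=> xc; split=> y; last by left; apply: Tag01 tx.
    by case: (classic (Tag0 t y)) => [ty|]; [right; rewrite -(Tag0_inj tx ty) | left].
have P1 c e t x : Pair p c e -> Tag1 t x ->
    (E t p <-> E x e) /\ (N t p <-> N x e).
  move=> hp tx; rewrite (setofT _ hp) (setofF _ hp); split; split.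
  - by case=> -[y [ty]]; [case: (Tag01 ty tx) | rewrite (Tag1_inj tx ty)].
  - by move=> xc; right; exists x.
  - by case=> _ /(_ x) [].
  - move=> xc; split=> y; first by left=> ty; apply: Tag01 ty tx.
    by case: (classic (Tag1 t y)) => [ty|]; [right; rewrite -(Tag1_inj tx ty) | left].
move=> hp hp'; split; apply: ax_ext => x.
  have tx : Tag0 (sg (sg x)) x by apply/Tag0E.
  by move: (P0 _ _ _ _ hp tx) (P0 _ _ _ _ hp' tx); tauto.
have [t /(_ t) [_ /(_ erefl) tx]] := Tag1_fun x.
by move: (P1 _ _ _ _ hp tx) (P1 _ _ _ _ hp' tx); tauto.
Qed.

Definition pr (a b : D) : D := epsilon (inhabits a) (fun p => Pair p a b).

Lemma PairE p a b : Pair p a b <-> p = pr a b.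
Proof.
have hp : Pair (pr a b) a b by exact: epsilon_spec (Pair_ex a b).
by split=> [h | ->] //; apply: Pair_uniq h hp.
Qed.

Lemma pr_inj a b a' b' : pr a b = pr a' b' -> a = a' /\ b = b'.
Proof. by move/PairE; apply: Pair_inj; apply/PairE. Qed.

(** Pairs exist and are unique by now, so this reading as an equation, rather than [iT_is_pair], is
    what [sem] uses. *)
Lemma iT_is_prE s d x y z p a b :
  den s d x p -> den s d y a -> den s d z b ->
  istrue s (is_pair x y z d) <-> p = pr a b.
Proof. by move=> *; rewrite -PairE; apply: iT_is_pair. Qed.

Hint Resolve iT_is_prE : sem.

(** * Meaning of products, sums, cardinals and decompositions *)

Definition Prod S A B : Prop :=
  setof S (fun z => exists x y, z = pr x y /\ (E x A /\ E y B))
          (fun z => forall x y, z <> pr x y \/ (N x A \/ N y B)).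

Lemma iT_is_prod s d x y z S A B :
  den s d x S -> den s d y A -> den s d z B ->
  istrue s (is_prod x y z d) <-> Prod S A B.
Proof. by move=> *; rewrite /is_prod /Prod; sem. Qed.

Definition Dsum S A B : Prop :=
  exists o i, ext o (fun=> False) /\ ext i (eq^~ o) /\
    setof S (fun z => (exists x, z = pr x o /\ E x A) \/
                      (exists x, z = pr x i /\ E x B))
            (fun z => (forall x, z <> pr x o \/ N x A) /\
                      (forall x, z <> pr x i \/ N x B)).

Lemma iT_is_dsum s d x y z S A B :
  den s d x S -> den s d y A -> den s d z B ->
  istrue s (is_dsum x y z d) <-> Dsum S A B.
Proof. by move=> *; rewrite /is_dsum /Dsum; sem. Qed.

Lemma iT_maps_to s d x y z (f a b : D) :
  den s d x f -> den s d y a -> den s d z b ->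
  istrue s (maps_to x y z d) <-> E (pr a b) f.
Proof.
move=> *; rewrite /maps_to.
apply: (iff_trans (B := exists p, p = pr a b /\ E p f)); first sem.
by split=> [[p [-> ]] | h]; [| exists (pr a b)].
Qed.

Hint Resolve iT_is_prod iT_is_dsum iT_maps_to : sem.

Definition Bij (f X Y : D) : Prop :=
  (Cls f
   /\ (forall p, E p f -> exists x, E x X /\ exists y, p = pr x y)
   /\ (forall x, E x X -> exists y, forall y', E (pr x y') f <-> y' = y))
  /\ (forall x, E x X -> forall y, E (pr x y) f -> E y Y)
  /\ (forall y, E y Y -> exists x, forall x', E (pr x' y) f <-> x' = x).

Lemma iT_equipotent s d x y X Y :
  den s d x X -> den s d y Y ->
  istrue s (equipotent x y d) <-> exists f : D, Bij f X Y.
Proof. by move=> *; rewrite /equipotent /is_bij /is_fun_on /Bij; sem. Qed.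

Hint Resolve iT_equipotent : sem.

Definition Clcard (a X : D) : Prop :=
  Cls X /\ Ord a /\ (exists f : D, Bij f X a)
  /\ (forall b, Ord b /\ (exists f : D, Bij f X b) -> E a b \/ a = b).

Lemma iT_is_clcard s d x y a X :
  den s d x a -> den s d y X -> istrue s (is_clcard x y d) <-> Clcard a X.
Proof. by move=> *; rewrite /is_clcard /Clcard; sem. Qed.

Hint Resolve iT_is_clcard : sem.

Definition Kc (a : D) (P : D -> Prop) : Prop :=
  exists B, ext B P /\ Clcard a B.

Definition Card (k A : D) : Prop :=
  exists cpos cque cb ct cn X Y Z,
    Kc cpos (psat Pos A) /\ Kc cque (psat Que A) /\ Kc cb (psat Bp A)
    /\ Kc ct (psat Tp A) /\ Kc cn (psat Np A)
    /\ Bi X cpos cque /\ Bi Y ct cque /\ Bi Z cb cn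
    /\ exists q, q = pr X Y /\ k = pr q Z.

Lemma iT_is_card s d x y k A :
  den s d x k -> den s d y A -> istrue s (is_card x y d) <-> Card k A.
Proof.
by move=> *; rewrite /is_card /is_clcard_of /is_triple /Card /Kc; sem.
Qed.

Hint Resolve iT_is_card : sem.

Definition Cadd (m k l : D) : Prop :=
  exists A B S, Card k A /\ Card l B /\ Dsum S A B /\ Card m S.

Lemma iT_is_cadd s d x y z m k l :
  den s d x m -> den s d y k -> den s d z l ->
  istrue s (is_cadd x y z d) <-> Cadd m k l.
Proof. by move=> *; rewrite /is_cadd /Cadd; sem. Qed.

Definition Cmul (m k l : D) : Prop :=
  exists A B S, Card k A /\ Card l B /\ Prod S A B /\ Card m S.

Lemma iT_is_cmul s d x y z m k l :
  den s d x m -> den s d y k -> den s d z l ->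
  istrue s (is_cmul x y z d) <-> Cmul m k l.
Proof. by move=> *; rewrite /is_cmul /Cmul; sem. Qed.

Definition FrakB (k : D) : Prop :=
  exists e u A, ext e (fun=> False) /\ ext u (eq^~ e) /\
    Tri A u e e /\ Card k A.

Lemma iT_is_frak_b s d x k :
  den s d x k -> istrue s (is_frak_b x d) <-> FrakB k.
Proof. by move=> *; rewrite /is_frak_b /FrakB; sem. Qed.

Definition FrakN (k : D) : Prop :=
  exists e u A, ext e (fun=> False) /\ ext u (eq^~ e) /\
    Tri A e e u /\ Card k A.

Lemma iT_is_frak_n s d x k :
  den s d x k -> istrue s (is_frak_n x d) <-> FrakN k.
Proof. by move=> *; rewrite /is_frak_n /FrakN; sem. Qed.

Hint Resolve iT_is_cadd iT_is_cmul iT_is_frak_b iT_is_frak_n : sem.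

Definition Decomp (k t b n : D) : Prop :=
  exists fb fn bb nn tb,
    FrakB fb /\ FrakN fn /\ Cmul bb b fb /\ Cmul nn n fn
    /\ Cadd tb t bb /\ Cadd k tb nn.

Lemma iT_is_decomposition s d x y z w k t b n :
  den s d x k -> den s d y t -> den s d z b -> den s d w n ->
  istrue s (is_decomposition x y z w d) <-> Decomp k t b n.
Proof. by move=> *; rewrite /is_decomposition /Decomp; sem. Qed.

Definition ClCardinal (k : D) : Prop := exists X, Cls X /\ Card k X.

Lemma iT_classical_cardinal s d x k :
  den s d x k -> istrue s (classical_cardinal x d) <-> ClCardinal k.
Proof. by move=> *; rewrite /classical_cardinal /ClCardinal; sem. Qed.

Hint Resolve iT_is_decomposition iT_classical_cardinal : sem.

(** * Equinumerosity *)

Lemma predext (P Q : D -> Prop) : (forall x, P x <-> Q x) -> P = Q.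
Proof.
by move=> h; apply: functional_extensionality => x; apply: propositional_extensionality.
Qed.

(** Stated for predicates that are extensions of classical sets, so that parts of sets can be
    compared and rewritten without naming the sets that collect them. *)
Definition eqp (P Q : D -> Prop) : Prop :=
  isset P /\ isset Q /\ exists f : D,
    Cls f /\ (forall p, E p f -> exists x y, P x /\ p = pr x y)
    /\ (forall x, P x -> exists y, Q y /\ forall y', E (pr x y') f <-> y' = y)
    /\ (forall y, Q y -> exists x, P x /\ forall x', E (pr x' y) f <-> x' = x).

Lemma def2_graph (R : D -> D -> Prop) :
  def2 R -> def2 (fun x p => exists y, R x y /\ p = pr x y).
Proof.
case=> phi [s [fr2 fr4 H]].
(* Name 1 holds the pair, but [phi] expects its own value there; the pair is therefore saved under 3
   before 1 is rebound. Overwriting 3 is harmless because the truth of [phi] is fixed by 0, 1 and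
   the names above 4. *)
exists (fExi 3 (fAnd (fEql 3 1) (fExi 1 (fAnd phi (is_pair 3 0 1 9))))), s.
split; rewrite /= ?(negbTE fr2) ?(negbTE fr4) //.
move=> s' es.
have H2 z y : istrue (upd (upd s' 3 z) 1 y) phi <-> R (s' 0) y.
  apply: (H (upd (upd s' 3 z) 1 y)) => n lt4n; rewrite -es // /upd.
  by case: n lt4n => [|[|[|[|]]]].
have H3 z y : istrue (upd (upd s' 3 z) 1 y) (is_pair 3 0 1 9) <->
    z = pr (s' 0) y.
  by apply: iT_is_prE.
change ((exists z, z = s' 1 /\ exists y, istrue (upd (upd s' 3 z) 1 y) phi /\
    istrue (upd (upd s' 3 z) 1 y) (is_pair 3 0 1 9)) <->
    exists y, R (s' 0) y /\ s' 1 = pr (s' 0) y).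
split=> [[z [<- [y [/H2 Ry /H3 zy]]]] | [y [Ry zy]]]; first by exists y.
by exists (s' 1); split=> //; exists y; rewrite H2 H3.
Qed.

(** Replacement does all the work: [Q] is the image of [P] under [R], and the graph is the image of
    [P] under the map from x to the pair of x and its value. *)
Lemma mkeqp (P Q : D -> Prop) (R : D -> D -> Prop) : isset P -> def2 R ->
  (forall x, P x -> exists y, Q y /\ forall y', R x y' <-> y' = y) ->
  (forall y, Q y -> exists x, P x /\ R x y) ->
  (forall x x' y, P x -> P x' -> R x y -> R x' y -> x = x') ->
  eqp P Q.
Proof.
move=> sP dR tot sur inj.
have Q_im : Q = (fun y => exists x, P x /\ R x y).
  apply: predext => y; split=> [/sur // | [x [/tot [z [Qz hz]] /hz ->]]] //.
have sQ : isset Q.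
  by rewrite Q_im; apply: repl => // x /tot [y [_ hy]]; exists y.
split=> //; split=> //.
have [f hf] : isset (fun p => exists x, P x /\ exists y, R x y /\ p = pr x y).
  apply: repl (def2_graph dR) _ => // x /tot [y [_ hy]]; exists (pr x y) => p.
  by split=> [[z [/hy -> ->]] | ->] //; exists y; split=> //; apply/hy.
have fE x y : E (pr x y) f <-> P x /\ R x y.
  rewrite (extT _ hf); split=> [[x' [Px' [y' [Ry' /pr_inj [-> ->]]]]] | [Px Rxy]] //.
  by exists x; split=> //; exists y.
exists f; split; first exact: ext_cls hf.
split=> [p /(extT _ hf) [x [Px [y [Rxy ->]]]] |]; first by exists x, y.
split=> [x Px | y Qy].
  have [y [Qy hy]] := tot x Px; exists y; split=> // y'.
  by rewrite fE hy; tauto.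
have [x [Px Rxy]] := sur y Qy; exists x; split=> // x'; rewrite fE.
by split=> [[Px' Rx'y] | -> //]; apply: inj Rx'y Rxy.
Qed.

Lemma eqp_Bij X Y :
  Cls X -> Cls Y -> (exists f : D, Bij f X Y) <-> eqp (E^~ X) (E^~ Y).
Proof.
move=> clX clY; split.
  move=> [f [[clf [fp ftot]] [fY fsur]]]; split; first by exists X; apply: cls_ext.
  split; first by exists Y; apply: cls_ext.
  exists f; split=> //; split=> [p /fp [x [Xx [y ->]]] |]; first by exists x, y.
  split=> [x Xx | y /fsur [x hx]].
    have [y hy] := ftot x Xx; exists y; split=> //.
    by apply: fY Xx _ _; apply/hy.
  exists x; split=> //; have /fp [x' [Xx' [y' /pr_inj [-> _]]]] // : E (pr x y) f.
  by apply/hx.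
move=> [_ [_ [f [clf [fp [ftot fsur]]]]]]; exists f; split; last split.
- split=> //; split=> [p /fp [x [y [Xx ->]]] | x /ftot [y [_ hy]]]; last by exists y.
  by exists x; split=> //; exists y.
- by move=> x /ftot [y [Yy hy]] y' /hy ->.
- by move=> y /fsur [x [_ hx]]; exists x.
Qed.

Lemma eqp_refl (P : D -> Prop) : isset P -> eqp P P.
Proof.
move=> sP; case: (dom_inhabited M) => a; apply: (mkeqp (R := fun x y => y = x)) => //.
- by apply: (@def2I (pEql 1 0) a a a a) => // s x y *; sem.
- by move=> x Px; exists x.
- by move=> x Px; exists x.
- by move=> x x' y _ _ <-.
Qed.

Lemma eqp_sym (P Q : D -> Prop) : eqp P Q -> eqp Q P.
Proof.
move=> [sP [sQ [f [clf [fp [ftot fsur]]]]]].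
apply: (mkeqp (R := fun y x => E (pr x y) f)) => //.
- by apply: (@def2I (maps_to 5 1 0) f f f f) => // s x y *; sem.
- by move=> x /ftot [y [Qy hy]]; exists y; split=> //; apply/hy.
- move=> y y' x _ _ fxy; have [x' [y1 [Px /pr_inj [ex _]]]] := fp _ fxy.
  by have [y2 [_ hy]] := ftot x' Px; move: fxy; rewrite ex !hy => -> ->.
Qed.

Lemma eqp_trans (P Q S : D -> Prop) : eqp P Q -> eqp Q S -> eqp P S.
Proof.
move=> [sP [sQ [f [clf [fp [ftot fsur]]]]]] [_ [sS [g [clg [gp [gtot gsur]]]]]].
apply: (mkeqp (R := fun x z => exists y, E (pr x y) f /\ E (pr y z) g)) => //.
- apply: (@def2I (fun d => (∃ y, maps_to 5 0 y ∧ maps_to 6 y 1)%bs4 d) f g f f) => //.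
  by move=> s x y *; sem.
- move=> x /ftot [y [Qy hy]]; have [z [Sz hz]] := gtot y Qy.
  exists z; split=> // z'; split=> [[y' [/hy -> /hz]] | ->] //.
  by exists y; rewrite hy hz.
- move=> z /gsur [y [Qy hy]]; have [x [Px hx]] := fsur y Qy.
  by exists x; split=> //; exists y; rewrite hx hy.
- move=> x x' z Px Px' [y [fxy gyz]] [y' [fxy' gyz']].
  have [y1 [Qy1 hy1]] := ftot x Px; have [z1 [Sz1 hz1]] := gtot y1 Qy1.
  have Sz : S z by move: gyz; rewrite (proj1 (hy1 y) fxy) hz1 => ->.
  have [y2 [Qy2 hy2]] := gsur z Sz; have [x2 [_ hx2]] := fsur y2 Qy2.
  move: fxy fxy'; rewrite (proj1 (hy2 y) gyz) (proj1 (hy2 y') gyz').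
  by rewrite !hx2 => -> ->.
Qed.

Lemma eqp_empty (P Q : D -> Prop) :
  eqp P Q -> (forall x, ~ Q x) -> forall x, ~ P x.
Proof.
by move=> [_ [_ [f [_ [_ [ftot _]]]]]] nQ x /ftot [y [/nQ]].
Qed.

Lemma eqp_single (P Q : D -> Prop) y0 :
  eqp P Q -> Q = eq^~ y0 -> exists x0, P = eq^~ x0.
Proof.
move=> [_ [_ [f [_ [_ [ftot fsur]]]]]] eQ; rewrite {}eQ in ftot fsur.
have [x0 [Px0 hx0]] := fsur y0 erefl; exists x0; apply: predext => x.
split=> [Px | -> //]; apply/hx0.
by have [y [ey hy]] := ftot x Px; apply/hy.
Qed.

(** Separating with [bang p] makes the condition two-valued, so the falsity condition of [p] need
    not be computed. *)
Lemma isset_sepI (p : pform) a b (P : D -> Prop) :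
  small P -> ~~ free 2 (p 9) ->
  (forall s x, den s 9 0 x -> den s 9 3 a -> den s 9 4 b ->
     istrue s (p 9) <-> P x) ->
  isset P.
Proof.
move=> sP fr H; apply: isset_sep => //.
apply: (@def1I (bang p) a b b b b b); first by rewrite /= orbF.
by move=> s x dx da db _ _ _ _; split; [apply: iT_bang | apply: iF_bang]; apply: H.
Qed.

Lemma isset_psat i A : isset (psat i A).
Proof.
have sP : small (psat i A).
  apply: small_sub (small_realm A) => x.
  by case: i; rewrite /psat /=; tauto.
have sepA (p : pform) : ~~ free 2 (p 9) ->
    (forall s x, den s 9 0 x -> den s 9 3 A -> istrue s (p 9) <-> psat i A x) ->
    isset (psat i A).
  by move=> fr H; apply: (@isset_sepI p A A) => // s x dx dA _; apply: H.
by case: i {sP} sepA => sepA;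
  [ apply: (sepA (0 ∈ 3)%bs4) => //
  | apply: (sepA (que (0 ∈ 3))%bs4) => //
  | apply: (sepA (0 ∈ 3 ∧ ∼ (0 ∈ 3))%bs4) => //
  | apply: (sepA (0 ∈ 3 ∧ que (0 ∈ 3))%bs4) => //
  | apply: (sepA (que (0 ∈ 3) ∧ ¬ (0 ∈ 3))%bs4) => // ];
  move=> s x *; cbv [psat pval]; sem.
Qed.

(** * Sets with prescribed positive and negative extensions *)

Lemma glut_gap :
  (exists x A, E x A /\ N x A) /\ (exists x A, ~ E x A /\ ~ N x A).
Proof.
(* The disjunction lists the two ways in which the conjunction behind [⇒] can be false; they amount
   to the same. A member of A^! outside A^? is a glut, and a member of A^? outside A^! is a gap. *)
have : (exists A X Y, ext X (psat Pos A) /\ ext Y (psat Que A) /\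
         exists x, (E x X /\ N x Y) \/ (N x Y /\ E x X)) /\
       (exists A X Y, ext X (psat Pos A) /\ ext Y (psat Que A) /\
         exists x, (E x Y /\ N x X) \/ (N x X /\ E x Y)).
  apply: (axE bzfc_acla) => s.
  by rewrite /sentence /AxACLA /subset /simp; sem.
case=> [[A [X [Y [hX [hY [x h]]]]]] [B [X' [Y' [hX' [hY' [x' h']]]]]]].
split; [exists x, A | exists x', B].
  by move: h; rewrite (extT _ hX) (extF _ hY) /psat /=; case: (classic (N x A)); tauto.
by move: h'; rewrite (extT _ hY') (extF _ hX') /psat /=; tauto.
Qed.

(* In BS4 a formula (p ∧ g) ∨ (q ∧ h) with p, q classical, g both true and
   false and h neither is true iff p is true and false iff q is false. *)
Lemma mk2 (P Q : D -> Prop) :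
  isset P -> isset Q -> exists A, setof A P (fun x => ~ Q x).
Proof.
move=> sP sQ; have small_PQ := small_or (isset_small sP) (isset_small sQ).
have [X hX] := sP; have [Y hY] := sQ.
have [[g [G [gT gF]]] [h [H [hT hF]]]] := glut_gap.
apply: mkset; first by apply: small_sub small_PQ => x; case: (classic (Q x)); tauto.
apply: (@def1I (fun d => ((0 ∈ 3 ∧ 5 ∈ 6) ∨ (0 ∈ 4 ∧ 7 ∈ 8))%bs4 d)
  X Y g G h H) => //.
move=> s x *; split.
  apply: (iff_trans (B := (E x X /\ E g G) \/ (E x Y /\ E h H))); first sem.
  by rewrite (extT _ hX); tauto.
apply: (iff_trans (B := (N x X \/ N g G) /\ (N x Y \/ N h H))); first sem.
by rewrite (extF _ hY); tauto.
Qed.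

Lemma Bi_ex X Y : Cls X -> Cls Y -> exists A, Bi A X Y.
Proof.
move=> clX clY.
have [A hA] := mk2 (ex_intro _ X (cls_ext clX)) (ex_intro _ Y (cls_ext clY)).
exists A; split=> x; move: (hA x) (clX x) (clY x); rewrite /psat /=;
  by case: (classic (E x Y)); case: (classic (N x X)); tauto.
Qed.

Lemma Bi_uniq A B X Y : Bi A X Y -> Bi B X Y -> A = B.
Proof.
move=> [hAX hAY] [hBX hBY]; apply: ax_ext => x.
move: (extT x hAX) (extT x hBX) (extT x hAY) (extT x hBY); rewrite /psat /=.
by case: (classic (N x A)); case: (classic (N x B)); tauto.
Qed.

Lemma Bi_inj A X Y X' Y' : Bi A X Y -> Bi A X' Y' -> X = X' /\ Y = Y'.
Proof. by move=> [hX hY] [hX' hY']; split; apply: ext_uniq; eassumption. Qed.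

(** * Ordinals as cardinals, and cardinal numbers *)

Lemma KcE a (P : D -> Prop) :
  Kc a P <-> [/\ Ord a, eqp P (E^~ a) &
              forall b, Ord b -> eqp P (E^~ b) -> E a b \/ a = b].
Proof.
have eP B : ext B P -> P = E^~ B by move=> hB; apply: predext => x; rewrite (extT _ hB).
split=> [[B [hB [clB [oa [/eqp_Bij h min]]]]] | [oa h min]].
  rewrite (eP B) //; split=> // [| b ob /eqp_Bij hb].
    by apply: h => //; case: oa.
  by apply: min; split=> //; apply: hb => //; case: ob.
have [[B hB] _] := h; exists B; rewrite (eP B) // in h min *.
have clB := ext_cls hB.
split; [exact: cls_ext | split=> //; split=> //; split].
  by apply/eqp_Bij => //; case: oa.
by move=> b [ob /eqp_Bij hb]; apply: min => //; apply: hb => //; case: ob.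
Qed.

Lemma Kc_uniq a b (P : D -> Prop) : Kc a P -> Kc b P -> a = b.
Proof.
move=> /KcE [oa ea mina] /KcE [ob eb minb].
case: (mina b ob eb) => // ab; case: (minb a oa ea) => // ba.
case: ob => [_ [_ [tr [irr _]]]]; have bb := tr a ab b ba.
by case: (irr b bb bb).
Qed.

Lemma Kc_eqp a (P Q : D -> Prop) : Kc a P -> eqp P Q -> Kc a Q.
Proof.
move=> /KcE [oa ea mina] PQ; apply/KcE; split=> // [| b ob Qb].
  exact: eqp_trans (eqp_sym PQ) ea.
by apply: mina => //; apply: eqp_trans PQ Qb.
Qed.

Lemma Kc_same a (P Q : D -> Prop) : Kc a P -> Kc a Q -> eqp P Q.
Proof. by move=> /KcE [_ ea _] /KcE [_ eb _]; apply: eqp_trans ea (eqp_sym eb). Qed.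

Lemma Kc_cls a (P : D -> Prop) : Kc a P -> Cls a.
Proof. by move=> /KcE [[]]. Qed.

Lemma emp_uniq A : Cls A -> (forall x, ~ E x A) -> A = emp.
Proof.
move=> clA A0; apply: ext_uniq ext_emp => x.
by have := clA x; have := A0 x; case: (classic (N x A)); tauto.
Qed.

(** 0 and 1 count the parts of the sets behind 𝔟 and 𝔫. As |A| need not supply them, they are
    verified to be least ordinals by hand. *)
Lemma Kc0 : Kc emp (fun=> False).
Proof.
have e0 : E^~ emp = (fun=> False).
  by apply: predext => x; apply: extT ext_emp.
apply/KcE; rewrite e0; split; last first.
- move=> b [clb _] /eqp_sym/eqp_empty b0; right.
  by apply/esym/(emp_uniq clb)/b0 => x [].
- exact: eqp_refl isset0.
have no x : ~ E x emp by rewrite (extT _ ext_emp).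
split; first exact: ext_cls ext_emp.
do 5 (split; first by move=> x /no).
by move=> z [_ [zs [x /(proj1 (zs x))/no]]].
Qed.

Lemma Kc1 : Kc (sg emp) (eq^~ emp).
Proof.
have no x : ~ E x emp by rewrite (extT _ ext_emp).
have sgE x : E x (sg emp) <-> x = emp by apply: extT (ext_sg emp).
have e1 : E^~ (sg emp) = eq^~ emp by apply: predext.
apply/KcE; rewrite e1; split; last first.
(* An ordinal equinumerous with a singleton has one element y. By transitivity any element of y
   would be y itself, against irreflexivity; so y is empty and the ordinal is 1. *)
- move=> b [clb [clel [tr [irr _]]]] /eqp_sym/eqp_single /(_ erefl) [y hy].
  have bE x : E x b <-> x = y by rewrite -[E x b]/((E^~ b) x) hy.
  have yb : E y b by apply/bE.
  right; apply: ext_uniq (ext_sg emp) _ => //.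
  suff <- : y = emp by move=> x; have := cls_ext clb x; rewrite bE.
  apply: emp_uniq (clel y yb) _ => x xy.
  by have xb := tr y yb x xy; move: xy; rewrite (proj1 (bE x) xb); apply: irr.
- exact: eqp_refl (sing_isset emp).
split; first exact: ext_cls (ext_sg emp).
split; first by move=> x /sgE ->; apply: ext_cls ext_emp.
split; first by move=> x /sgE -> y /no.
split; first by move=> x /sgE -> /no.
split; first by move=> x /sgE -> y /sgE -> z /sgE -> [/no].
split; first by move=> x /sgE -> y /sgE ->; right; left.
move=> z [_ [zs [x xz]]]; exists x; split=> // y yz; right.
by rewrite (proj1 (sgE x) (proj1 (zs x) xz)) (proj1 (sgE y) (proj1 (zs y) yz)).
Qed.

Lemma CardE k A :
  Card k A <-> exists c : part -> D, (forall i, Kc (c i) (psat i A)) /\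
    exists X Y Z, [/\ Bi X (c Pos) (c Que), Bi Y (c Tp) (c Que),
                      Bi Z (c Bp) (c Np) & k = pr (pr X Y) Z].
Proof.
split=> [[cp [cq [cb [ct [cn [X [Y [Z]]]]]]]] | [c [hc [X [Y [Z [hX hY hZ ->]]]]]]].
  move=> [hp [hq [hb [ht [hn [hX [hY [hZ [q [-> ->]]]]]]]]]].
  exists (fun i => match i with
    | Pos => cp | Que => cq | Bp => cb | Tp => ct | Np => cn end).
  by split; [case | exists X, Y, Z].
exists (c Pos), (c Que), (c Bp), (c Tp), (c Np), X, Y, Z.
by do 5 (split; first exact: hc); do 3 (split=> //); exists (pr X Y).
Qed.

(** Equality of cardinal numbers in a form that makes sense before the cardinals are known to
    exist. *)
Definition same (A B : D) : Prop := forall i, eqp (psat i A) (psat i B).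

Lemma Card_same k A B : Card k A -> Card k B -> same A B.
Proof.
move=> /CardE [c [hc [X [Y [Z [hX hY hZ ->]]]]]].
move=> /CardE [c' [hc' [X' [Y' [Z' [hX' hY' hZ']]]]]].
move=> /pr_inj [/pr_inj [eX eY] eZ]; subst X' Y' Z'.
have [ep eq] := Bi_inj hX hX'; have [et _] := Bi_inj hY hY'.
have [eb en] := Bi_inj hZ hZ'.
suff ec i : c i = c' i by move=> i; apply: Kc_same (hc i) _; rewrite ec.
by case: i.
Qed.

Lemma same_Card k A B : same A B -> Card k A -> Card k B.
Proof.
move=> AB /CardE [c [hc hk]]; apply/CardE; exists c; split=> // i.
exact: Kc_eqp (hc i) (AB i).
Qed.

Lemma Card_uniq k k' A : Card k A -> Card k' A -> k = k'.
Proof.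
move=> /CardE [c [hc [X [Y [Z [hX hY hZ ->]]]]]].
move=> /CardE [c' [hc' [X' [Y' [Z' [hX' hY' hZ' ->]]]]]].
have ec i : c' i = c i by apply: Kc_uniq (hc' i) (hc i).
rewrite !ec in hX' hY' hZ'.
by rewrite (Bi_uniq hX hX') (Bi_uniq hY hY') (Bi_uniq hZ hZ').
Qed.

Lemma Card_ex A : (forall i, exists c, Kc c (psat i A)) -> exists k, Card k A.
Proof.
move=> h; have [cp hp] := h Pos; have [cq hq] := h Que.
have [cb hb] := h Bp; have [ct ht] := h Tp; have [cn hn] := h Np.
have [X hX] := Bi_ex (Kc_cls hp) (Kc_cls hq).
have [Y hY] := Bi_ex (Kc_cls ht) (Kc_cls hq).
have [Z hZ] := Bi_ex (Kc_cls hb) (Kc_cls hn).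
exists (pr (pr X Y) Z), cp, cq, cb, ct, cn, X, Y, Z.
by do 8 (split=> //); exists (pr X Y).
Qed.

Lemma Card_Kc k A i : Card k A -> exists c, Kc c (psat i A).
Proof. by move=> /CardE [c [hc _]]; exists (c i). Qed.

(** * The decomposition *)

(** These three parts partition the realm; A^! and A^? are unions of two of them. *)
Definition basic (j : part) : bool :=
  match j with Bp | Tp | Np => true | _ => false end.

(** Truth and falsity values of membership in a set all of whose members are of kind [j]: a glut for
    [Bp], plainly true for [Tp], a gap for [Np]. Where [P] fails, the value is always plainly
    false. *)
Definition posval (j : part) (P : Prop) : Prop := if j is Np then False else P.
Definition negval (j : part) (P : Prop) : Prop := if j is Bp then True else ~ P.

(* For basic j: rlm(A) is the j-part of A and has extension P. *)
Definition pure (j : part) (A : D) (P : D -> Prop) : Prop :=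
  setof A (fun x => posval j (P x)) (fun x => negval j (P x)).

Lemma pure_psat j A P : pure j A P -> forall i,
  psat i A = fun x => pval i (posval j (P x)) (negval j (P x)).
Proof.
move=> hA i; apply: predext => x; rewrite /psat.
by move: (hA x); case: i => /=; tauto.
Qed.

(** Each of the five parts of a pure set is everything or nothing, so a single ordinal or a single
    bijection settles its whole cardinal number. *)
Lemma pval_pure j i : basic j ->
  (forall P : Prop, pval i (posval j P) (negval j P) <-> P) \/
  (i <> j /\ forall P : Prop, pval i (posval j P) (negval j P) <-> False).
Proof.
by case: j => // _; case: i => /=;
  first [ left=> P; case: (classic P); tauto
        | right; split=> [// | P]; case: (classic P); tauto].
Qed.

Lemma pure_part j A P : basic j -> pure j A P -> forall i,
  psat i A = P \/ (i <> j /\ psat i A = fun=> False).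
Proof.
move=> bj hA i; rewrite (pure_psat hA).
by case: (pval_pure i bj) => [h | [ij h]]; [left | right; split=> //]; apply: predext.
Qed.

Lemma pure_self j A P : basic j -> pure j A P -> psat j A = P.
Proof. by move=> bj hA; case: (pure_part bj hA j) => // -[]. Qed.

Lemma pure_other j i A P : pure j A P -> basic j -> basic i -> i <> j ->
  forall x, ~ psat i A x.
Proof.
move=> hA bj bi ij x; rewrite (pure_psat hA).
by case: j bj ij {hA} => // _; case: i bi => //= _ _; tauto.
Qed.

Lemma pureI j A : basic j ->
  (forall i, basic i -> i <> j -> forall x, ~ psat i A x) ->
  pure j A (psat j A).
Proof.
move=> bj h x; have hB := h Bp isT; have hT := h Tp isT; have hN := h Np isT.
case: j bj {h} hB hT hN => // _ hB hT hN;
  (* A hypothesis is instantiated only if its premise [i <> j] is provable; the one for [j] itself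
     fails and is left alone. *)
  try (have {hB} := hB ltac:(done) x); try (have {hT} := hT ltac:(done) x);
  try (have {hN} := hN ltac:(done) x); rewrite /psat /=;
  by case: (classic (E x A)); case: (classic (N x A)); tauto.
Qed.

Lemma pure_ex j P : isset P -> exists A, pure j A P.
Proof.
move=> sP.
have s2 : isset (fun x => ~ negval j (P x)).
  have -> : (fun x => ~ negval j (P x)) = if j is Bp then fun=> False else P.
    by apply: predext => x; case: j => /=; case: (classic (P x)); tauto.
  by case: j => //; apply: isset0.
have s1 : isset (fun x => posval j (P x)).
  by case: j {s2} => //=; apply: isset0.
have [A hA] := mk2 s1 s2; exists A => x; move: (hA x).
by case: (classic (negval j (P x))); tauto.
Qed.

Lemma pure_cls A : Cls A <-> pure Tp A (E^~ A).
Proof. by split=> [/cls_ext | /ext_cls]. Qed.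

(** Purity depends only on the cardinal number, because it says that the other two basic parts are
    empty and equinumerosity preserves emptiness. *)
Lemma pure_trans j A B P : basic j -> same A B -> pure j A P ->
  exists Q, pure j B Q /\ eqp P Q.
Proof.
move=> bj AB hA; exists (psat j B); split; last by rewrite -(pure_self bj hA).
apply: pureI => // i bi ij; apply: eqp_empty (eqp_sym (AB i)) _.
exact: pure_other hA bj bi ij.
Qed.

Lemma pure_same j A B P Q :
  basic j -> pure j A P -> pure j B Q -> eqp P Q -> same A B.
Proof.
move=> bj hA hB PQ i; rewrite (pure_psat hA) (pure_psat hB).
case: (pval_pure i bj) => [h | [_ h]].
  have e (R : D -> Prop) : (fun x => pval i (posval j (R x)) (negval j (R x))) = R.
    by apply: predext => x; apply: h.
  by rewrite !e.
have e (R : D -> Prop) : (fun x => pval i (posval j (R x)) (negval j (R x))) = fun=> False.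
  by apply: predext => x; apply: h.
by rewrite !e; apply: eqp_refl isset0.
Qed.

Lemma pure_Card j A P c : basic j -> pure j A P -> Kc c P -> exists k, Card k A.
Proof.
move=> bj hA hc; apply: Card_ex => i.
by case: (pure_part bj hA i) => [-> | [_ ->]]; [exists c | exists emp; apply: Kc0].
Qed.

(** * Products with a one-point set, and disjoint sums *)

Lemma small_pairs A c :
  small (fun z => exists x, (E x A \/ ~ N x A) /\ z = pr x c).
Proof.
apply: (small_image (R := fun x z => z = pr x c) (small_realm A)).
  by apply: (@def2I (is_pair 1 0 5) c c c c) => // s x y *; sem.
by move=> x; exists (pr x c).
Qed.

(** For x in [P], membership of the pair of x and [y0] has the value of [y0] in [B], hence is of
    kind [j]; all other objects are plainly false. Pairing with [y0] is the bijection. *)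
Lemma Prod_pure j S A B P y0 : basic j ->
  Prod S A B -> pure Tp A P -> pure j B (eq^~ y0) ->
  exists Q, pure j S Q /\ eqp P Q.
Proof.
move=> bj hS hA hB; exists (fun z => exists x, P x /\ z = pr x y0); split; last first.
  apply: (mkeqp (R := fun x z => z = pr x y0)).
  - by exists A.
  - by apply: (@def2I (is_pair 1 0 5) y0 y0 y0 y0) => // s x y *; sem.
  - by move=> x Px; exists (pr x y0); split=> //; exists x.
  - by move=> z [x [Px ->]]; exists x.
  - by move=> x x' z _ _ -> /pr_inj [].
move=> z; rewrite (setofT _ hS) (setofF _ hS).
have EA x := setofT x hA; have NA x := setofF x hA.
have EB y := setofT y hB; have NB y := setofF y hB.
split; [split | split].
- move=> [x [y [-> [/EA /= Px /EB]]]].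
  by case: j bj {hB EB NB} => //= _ ->; exists x.
- case: j bj hB EB NB => //= _ hB EB NB [x [Px ->]]; exists x, y0;
    by rewrite EA EB.
- case: j bj hB EB NB => //= _ hB EB NB h [x [Px ez]];
    by have := h x y0; rewrite NA NB /=; tauto.
- case: j bj hB EB NB => //= _ hB EB NB h x y; rewrite NA NB /=; try tauto.
  all: case: (classic (P x)) => [Px|]; last tauto.
  all: case: (classic (y = y0)) => [-> | ]; last tauto.
  all: by left=> ez; apply: h; exists x.
Qed.

(** The realm of [B] is one point, so a single application of Replacement to the realm of [A] bounds
    the product. *)
Lemma Prod_ex j A B y0 : basic j -> pure j B (eq^~ y0) -> exists S, Prod S A B.
Proof.
move=> bj hB; apply: mkset; last first.
  apply: (@def1I (fun d => (∃ x y, bang (is_pair 0 x y) ∧ (x ∈ 3 ∧ y ∈ 4))%bs4 d)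
           A B A A A A) => //.
  by move=> s x *; split; sem.
apply: small_sub (small_pairs A y0) => z.
have EB y : E y B -> y = y0.
  by move/(setofT _ hB); case: j bj hB.
have NB y : ~ N y B -> y = y0.
  move=> h; apply: NNPP => ny; apply/h/(setofF _ hB).
  by case: j bj hB.
case=> [[x [y [-> [xA /EB ->]]]] | h]; first by exists x; split; [left|].
have [x /not_all_ex_not [y /not_or_and [/NNPP -> /not_or_and [xA /NB ->]]]] :=
  not_all_ex_not _ _ h.
by exists x; split; [right |].
Qed.

Lemma DsumE S A B :
  Dsum S A B <->
  setof S (fun z => (exists x, z = pr x emp /\ E x A) \/
                    (exists x, z = pr x (sg emp) /\ E x B))
          (fun z => (forall x, z <> pr x emp \/ N x A) /\
                    (forall x, z <> pr x (sg emp) \/ N x B)).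
Proof.
split=> [[o [i [ho [hi hS]]]] | hS].
  have eo := ext_uniq ho ext_emp; rewrite eo in hi hS.
  by rewrite (ext_uniq hi (ext_sg emp)) in hS.
exists emp, (sg emp); split; [exact: ext_emp | split=> //; exact: ext_sg].
Qed.

Lemma Dsum_ex A B : exists S, Dsum S A B.
Proof.
have [S hS] : exists S,
  setof S (fun z => (exists x, z = pr x emp /\ E x A) \/
                    (exists x, z = pr x (sg emp) /\ E x B))
          (fun z => (forall x, z <> pr x emp \/ N x A) /\
                    (forall x, z <> pr x (sg emp) \/ N x B)).
  apply: mkset; last first.
    apply: (@def1I (fun d => ((∃ x, bang (is_pair 0 x 5) ∧ x ∈ 3)
       ∨ (∃ x, bang (is_pair 0 x 6) ∧ x ∈ 4))%bs4 d) A B emp (sg emp) A A) => //.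
    by move=> s x *; split; sem.
  apply: small_sub (small_or (small_pairs A emp) (small_pairs B (sg emp))) => z.
  case=> [[[x [-> xA]] | [x [-> xB]]] | /not_and_or [] h].
  - by left; exists x; split; [left |].
  - by right; exists x; split; [left |].
  - have [x /not_or_and [/NNPP -> xA]] := not_all_ex_not _ _ h.
    by left; exists x; split; [right |].
  - have [x /not_or_and [/NNPP -> xA]] := not_all_ex_not _ _ h.
    by right; exists x; split; [right |].
by exists S; apply/DsumE.
Qed.

Lemma pr_0_1 x y : pr x emp <> pr y (sg emp).
Proof. by move=> /pr_inj [_ /esym/sg_neq0]. Qed.

(** Both embeddings preserve truth and falsity of membership, hence every part; an object in neither
    copy is plainly false and so lies in no part. *)
Lemma Dsum_psat S A B i : Dsum S A B ->
  [/\ forall x, psat i S (pr x emp) <-> psat i A x,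
      forall x, psat i S (pr x (sg emp)) <-> psat i B x
    & forall z, psat i S z -> exists x, z = pr x emp \/ z = pr x (sg emp)].
Proof.
have congr z x C : (E z S <-> E x C) -> (N z S <-> N x C) ->
    psat i S z <-> psat i C x.
  by rewrite /psat; case: i => /=; tauto.
move=> /DsumE hS; split=> [x | x | z].
- apply: congr; rewrite ?(setofT _ hS) ?(setofF _ hS); split.
  + by case=> -[y [ez]]; [case/pr_inj: ez => -> | case: (pr_0_1 ez)].
  + by move=> xA; left; exists x.
  + by case=> /(_ x) [].
  + move=> xA; split=> y; last by left; apply: pr_0_1.
    by case: (classic (x = y)) => [<- | xy]; [right | left=> /pr_inj []].
- apply: congr; rewrite ?(setofT _ hS) ?(setofF _ hS); split.
  + by case=> -[y [ez]]; [case: (pr_0_1 (esym ez)) | case/pr_inj: ez => ->].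
  + by move=> xB; right; exists x.
  + by case=> _ /(_ x) [].
  + move=> xB; split=> y; first by left=> /esym/pr_0_1.
    by case: (classic (x = y)) => [<- | xy]; [right | left=> /pr_inj []].
move=> Sz; apply: NNPP => h.
have zS : ~ E z S.
  by rewrite (setofT _ hS) => -[[x [ez _]] | [x [ez _]]]; apply: h; exists x; [left | right].
have zS' : N z S.
  by rewrite (setofF _ hS); split=> x; left=> ez; apply: h; exists x; [left | right].
by move: Sz; rewrite /psat; case: i {congr} => /=; tauto.
Qed.

(* The bijection is the first projection. *)
Lemma Dsum_eqp S A B i : Dsum S A B ->
  (forall x, psat i A x -> ~ psat i B x) ->
  eqp (psat i S) (fun x => psat i A x \/ psat i B x).
Proof.
move=> hS AB; have [S0 S1 Sz] := Dsum_psat i hS.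
apply: (mkeqp (R := fun z x => exists c, z = pr x c)).
- exact: isset_psat.
- apply: (@def2I (fun d => (∃ c, is_pair 0 1 c)%bs4 d) A A A A) => //.
  by move=> s x y *; sem.
- move=> z zS; have [x ez] := Sz z zS; exists x; split.
    by case: ez zS => ->; [move/S0; left | move/S1; right].
  by case: ez => ->; move=> y; split=> [[c /pr_inj []] // | ->]; eexists.
- move=> x [/S0 xS | /S1 xS]; first by exists (pr x emp); split=> //; exists emp.
  by exists (pr x (sg emp)); split=> //; exists (sg emp).
- move=> z z' x zS zS' [c ez] [c' ez'].
  have [y h] := Sz z zS; have [y' h'] := Sz z' zS'.
  have [ey ey'] : y = x /\ y' = x.
    by split; [case: h | case: h']; rewrite ?ez ?ez' => /pr_inj [].
  subst y y'; case: h h' zS zS' => -> [] -> // /[dup].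
  + by move=> /S0 /AB xB _ /S1.
  + by move=> /S1 xB _ /S0 /AB.
Qed.

Lemma Dsum_l S A B i : Dsum S A B -> (forall x, ~ psat i B x) ->
  eqp (psat i S) (psat i A).
Proof.
move=> hS B0; rewrite [psat i A](_ : _ = fun x => psat i A x \/ psat i B x).
  by apply: Dsum_eqp => // x _; apply: B0.
by apply: predext => x; have := B0 x; tauto.
Qed.

Lemma Dsum_r S A B i : Dsum S A B -> (forall x, ~ psat i A x) ->
  eqp (psat i S) (psat i B).
Proof.
move=> hS A0; rewrite [psat i B](_ : _ = fun x => psat i A x \/ psat i B x).
  by apply: Dsum_eqp => // x /A0.
by apply: predext => x; have := A0 x; tauto.
Qed.

Lemma ext_inj A (P Q : D -> Prop) : ext A P -> ext A Q -> P = Q.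
Proof. by move=> hP hQ; apply: predext => x; rewrite -(extT _ hP) (extT _ hQ). Qed.

(** * The cardinals 𝔟 and 𝔫 *)

Lemma FrakB_pure k : FrakB k -> exists A y, Card k A /\ pure Bp A (eq^~ y).
Proof.
move=> [e [u [A [he [hu [[hb [ht hn]] hk]]]]]]; exists A, e; split=> //.
rewrite -(ext_inj hb hu).
have e0 x : ~ E x e by rewrite (extT _ he).
by apply: pureI => // -[] // _ _ x; [rewrite -(extT _ ht) | rewrite -(extT _ hn)]; apply: e0.
Qed.

Lemma FrakN_pure k : FrakN k -> exists A y, Card k A /\ pure Np A (eq^~ y).
Proof.
move=> [e [u [A [he [hu [[hb [ht hn]] hk]]]]]]; exists A, e; split=> //.
rewrite -(ext_inj hn hu).
have e0 x : ~ E x e by rewrite (extT _ he).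
by apply: pureI => // -[] // _ _ x; [rewrite -(extT _ hb) | rewrite -(extT _ ht)]; apply: e0.
Qed.

Lemma frak_ex j : basic j ->
  exists k A, pure j A (eq^~ emp) /\ Card k A.
Proof.
move=> bj; have [A hA] := pure_ex j (sing_isset emp).
by have [k hk] := pure_Card bj hA Kc1; exists k, A.
Qed.

Lemma FrakB_ex : exists k, FrakB k.
Proof.
have [k [A [hA hk]]] := @frak_ex Bp isT; exists k, emp, (sg emp), A.
have ext0 i : i <> Bp -> basic i -> ext emp (psat i A).
  move=> ij bi; rewrite (_ : psat i A = fun=> False); first exact: ext_emp.
  have no x : ~ psat i A x by apply: (pure_other hA).
  by apply: predext => x; have := no x; tauto.
split; first exact: ext_emp; split; first exact: ext_sg.
split=> //; split; first by rewrite (pure_self (j := Bp) isT hA); apply: ext_sg.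
by split; apply: ext0.
Qed.

Lemma FrakN_ex : exists k, FrakN k.
Proof.
have [k [A [hA hk]]] := @frak_ex Np isT; exists k, emp, (sg emp), A.
have ext0 i : i <> Np -> basic i -> ext emp (psat i A).
  move=> ij bi; rewrite (_ : psat i A = fun=> False); first exact: ext_emp.
  have no x : ~ psat i A x by apply: (pure_other hA).
  by apply: predext => x; have := no x; tauto.
split; first exact: ext_emp; split; first exact: ext_sg.
split=> //; split; first exact: ext0.
by split; [apply: ext0 | rewrite (pure_self (j := Np) isT hA); apply: ext_sg].
Qed.

(** One pure representative is enough: by [pcard_pure] every other representative is pure with an
    equinumerous realm, which handles the arbitrary choices inside [Cadd] and [Cmul]. *)
Definition pcard (j : part) (k : D) (P : D -> Prop) : Prop :=
  exists A, Card k A /\ pure j A P.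

Lemma pcard_pure j k P A : basic j -> pcard j k P -> Card k A ->
  exists Q, pure j A Q /\ eqp P Q.
Proof.
move=> bj [B [hB pB]] hA; exact: pure_trans bj (Card_same hB hA) pB.
Qed.

Lemma pcard_uniq j k k' P Q :
  basic j -> pcard j k P -> pcard j k' Q -> eqp P Q -> k = k'.
Proof.
move=> bj [A [hA pA]] [B [hB pB]] PQ.
exact: Card_uniq (same_Card (pure_same bj pA pB PQ) hA) hB.
Qed.

Lemma ClCardinal_pcard k : ClCardinal k -> exists P, pcard Tp k P.
Proof. by move=> [X [/pure_cls clX hX]]; exists (E^~ X), X. Qed.

Lemma Cmul_pcard j m k l P y0 : basic j ->
  pcard Tp k P -> pcard j l (eq^~ y0) -> Cmul m k l ->
  exists Q, pcard j m Q /\ eqp P Q.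
Proof.
move=> bj hk hf [A [B [S [hA [hB [hS hm]]]]]].
have [P' [pA PP']] := pcard_pure (j := Tp) isT hk hA.
have [Q' [pB /eqp_sym/eqp_single /(_ erefl) [y eQ']]] := pcard_pure bj hf hB.
rewrite eQ' in pB; have [Q [pS P'Q]] := Prod_pure bj hS pA pB.
by exists Q; split; [exists S | apply: eqp_trans PP' P'Q].
Qed.

(** * Uniqueness: a decomposition determines its coefficients *)

Lemma Decomp_parts k t b n A : Card k A ->
  ClCardinal t -> ClCardinal b -> ClCardinal n -> Decomp k t b n ->
  [/\ exists P, pcard Tp t P /\ eqp P (psat Tp A),
      exists P, pcard Tp b P /\ eqp P (psat Bp A)
    & exists P, pcard Tp n P /\ eqp P (psat Np A)].
Proof.
move=> hA /ClCardinal_pcard [Pt ht] /ClCardinal_pcard [Pb hb].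
move=> /ClCardinal_pcard [Pn hn] [fb [fn [bb [nn [tb]]]]].
move=> [/FrakB_pure [Fb [yb [hFb pFb]]] [/FrakN_pure [Fn [yn [hFn pFn]]]]].
move=> [mb [mn [[A1 [B1 [S1 [hA1 [hB1 [dS1 hS1]]]]]]]]].
move=> [A2 [B2 [S2 [hA2 [hB2 [dS2 hS2]]]]]].
have [Qb [hbb Pb_Qb]] := Cmul_pcard (j := Bp) isT hb (ex_intro _ Fb (conj hFb pFb)) mb.
have [Qn [hnn Pn_Qn]] := Cmul_pcard (j := Np) isT hn (ex_intro _ Fn (conj hFn pFn)) mn.
have [P1 [pA1 PtP1]] := pcard_pure (j := Tp) isT ht hA1.
have [R1 [pB1 QbR1]] := pcard_pure (j := Bp) isT hbb hB1.
have [R2 [pB2 QnR2]] := pcard_pure (j := Np) isT hnn hB2.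
(* The two sums use unrelated representatives. They are linked only by cardinals: [S2] and [A] share
   [k], while [S1] and [A2] share [tb]. *)
have S2A : same S2 A by exact: Card_same hS2 hA.
have S1A2 : same S1 A2 by exact: Card_same hS1 hA2.
have oB2 i : basic i -> i <> Np -> forall x, ~ psat i B2 x.
  by move=> *; apply: (pure_other pB2).
have AA2 i : basic i -> i <> Np -> eqp (psat i S1) (psat i A).
  move=> bi iN; apply: eqp_trans (S1A2 i) (eqp_trans _ (S2A i)).
  by apply/eqp_sym/(Dsum_l dS2)/oB2.
split; [exists Pt | exists Pb | exists Pn]; split=> //.
- apply: eqp_trans (AA2 Tp isT _) => //; apply: eqp_trans PtP1 _.
  rewrite -(pure_self (j := Tp) isT pA1); apply/eqp_sym/(Dsum_l dS1).
  exact: (pure_other pB1).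
- apply: eqp_trans (AA2 Bp isT _) => //; apply: eqp_trans (eqp_trans Pb_Qb QbR1) _.
  rewrite -(pure_self (j := Bp) isT pB1); apply/eqp_sym/(Dsum_r dS1).
  exact: (pure_other pA1).
(* The set [A2] is arbitrary, but its gappy part is equinumerous with that of [S1], which is empty
   because [A1] and [B1] have no gaps. *)
- apply: eqp_trans (S2A Np); apply: eqp_trans (eqp_trans Pn_Qn QnR2) _.
  rewrite -(pure_self (j := Np) isT pB2); apply/eqp_sym/(Dsum_r dS2).
  apply: eqp_empty (eqp_sym (S1A2 Np)) _; apply: eqp_empty (Dsum_l dS1 _) _.
    exact: (pure_other pB1).
  exact: (pure_other pA1).
Qed.

(** * Existence of a decomposition *)

Lemma Cmul_ex j k l X A P y c : basic j ->
  Card k X -> pure Tp X P -> Kc c P -> Card l A -> pure j A (eq^~ y) ->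
  exists m, Cmul m k l /\ pcard j m P.
Proof.
move=> bj hX pX hc hA pA; have [S hS] := Prod_ex X bj pA.
have [Q [pS PQ]] := Prod_pure bj hS pX pA.
have [m hm] := pure_Card bj pS (Kc_eqp hc PQ).
exists m; split; first by exists X, A, S.
(* The product consists of pairs. The same cardinal is represented again with realm [P] itself, so
   that the summands become pieces of the original set. *)
have [B pB] := pure_ex j (isset_psat Tp X); rewrite (pure_self (j := Tp) isT pX) in pB.
by exists B; split=> //; apply: same_Card hm; apply: pure_same pS pB (eqp_sym PQ).
Qed.

(** [U] stands for the union: when corresponding parts are disjoint, tagging the elements does not
    change the cardinal number. *)
Lemma Dsum_same S A B U : Dsum S A B ->
  (forall i x, psat i A x -> ~ psat i B x) ->
  (forall i x, psat i U x <-> psat i A x \/ psat i B x) -> same S U.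
Proof.
move=> hS AB UE i; rewrite (_ : psat i U = fun x => psat i A x \/ psat i B x).
  by apply: Dsum_eqp => // x; apply: AB.
by apply: predext.
Qed.

Lemma Decomp_ex k A : Card k A -> exists t b n,
  (ClCardinal t /\ ClCardinal b /\ ClCardinal n /\ Decomp k t b n).
Proof.
move=> hk.
have cl j : exists X c m,
    [/\ pure Tp X (psat j A), Kc c (psat j A) & Card m X].
  have [X pX] := pure_ex Tp (isset_psat j A); have [c hc] := Card_Kc j hk.
  by have [m hm] := pure_Card (j := Tp) isT pX hc; exists X, c, m.
have [T [ct [t [pT hct ht]]]] := cl Tp.
have [B [cb [b [pB hcb hb]]]] := cl Bp.
have [Nn [cn [n [pN hcn hn]]]] := cl Np.
have [fb hfb] := FrakB_ex; have [Fb [yb [hFb pFb]]] := FrakB_pure hfb.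
have [fn hfn] := FrakN_ex; have [Fn [yn [hFn pFn]]] := FrakN_pure hfn.
have [bb [mb [B' [hB' pB']]]] := Cmul_ex (j := Bp) isT hb pB hcb hFb pFb.
have [nn [mn [N' [hN' pN']]]] := Cmul_ex (j := Np) isT hn pN hcn hFn pFn.
(* [U] is ⟨A^!|A_t⟩, that is, A with its gaps removed. It is the union of [T] and [B'], and adding
   the gaps [N'] gives back A. *)
have [U hU] := mk2 (isset_psat Pos A) (isset_psat Tp A).
have [S1 dS1] := Dsum_ex T B'; have [S2 dS2] := Dsum_ex U N'.
have S1U : same S1 U.
  apply: Dsum_same dS1 _ _ => i x; rewrite (pure_psat pT) (pure_psat pB').
    by rewrite /psat; case: i => /=; tauto.
  rewrite {1}/psat; move: (hU x); rewrite /psat.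
  by case: i => /=; case: (classic (E x A)); case: (classic (N x A)); tauto.
have S2A : same S2 A.
  apply: Dsum_same dS2 _ _ => i x; rewrite (pure_psat pN') {1 2}/psat;
    move: (hU x); rewrite /psat;
  by case: i => /=; case: (classic (E x A)); case: (classic (N x A)); tauto.
(* The five parts of [U], in the order of [part], are A^!, A_t, A_b, A_t and the empty set, so their
   ordinals come from |A| together with 0. *)
have [tb htb] : exists tb, Card tb U.
  have [cp hcp] := Card_Kc Pos hk.
  have UE x := hU x; rewrite /psat /= in UE.
  apply: Card_ex => -[].
  - exists cp; rewrite (_ : psat Pos U = psat Pos A) //.
    by apply: predext => x; have := UE x; rewrite /psat /=; tauto.
  - exists ct; rewrite (_ : psat Que U = psat Tp A) //.
    by apply: predext => x; have := UE x; rewrite /psat /=;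
      case: (classic (N x A)); case: (classic (E x A)); tauto.
  - exists cb; rewrite (_ : psat Bp U = psat Bp A) //.
    by apply: predext => x; have := UE x; rewrite /psat /=;
      case: (classic (N x A)); case: (classic (E x A)); tauto.
  - exists ct; rewrite (_ : psat Tp U = psat Tp A) //.
    by apply: predext => x; have := UE x; rewrite /psat /=;
      case: (classic (N x A)); case: (classic (E x A)); tauto.
  - exists emp; rewrite (_ : psat Np U = fun=> False); first exact: Kc0.
    by apply: predext => x; have := UE x; rewrite /psat /=;
      case: (classic (N x A)); case: (classic (E x A)); tauto.
have same_sym X Y : same X Y -> same Y X by move=> XY i; apply: eqp_sym.
exists t, b, n.
split; first by exists T; split=> //; apply: ext_cls pT.
split; first by exists B; split=> //; apply: ext_cls pB.
split; first by exists Nn; split=> //; apply: ext_cls pN.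
exists fb, fn, bb, nn, tb; do 4 (split=> //); split.
  by exists T, B', S1; do 3 (split=> //); apply: same_Card htb; apply: same_sym.
by exists U, N', S2; do 3 (split=> //); apply: same_Card hk; apply: same_sym.
Qed.

Lemma decomposition_exists_unique k : (exists A, Card k A) ->
  exists t b n,
    (ClCardinal t /\ ClCardinal b /\ ClCardinal n /\ Decomp k t b n)
    /\ (forall t' b' n',
          ClCardinal t' /\ ClCardinal b' /\ ClCardinal n'
            /\ Decomp k t' b' n' -> t' = t /\ b' = b /\ n' = n).
Proof.
move=> [A hA]; have [t [b [n [ht [hb [hn hd]]]]]] := Decomp_ex hA.
exists t, b, n; split=> // t' b' n' [ht' [hb' [hn' hd']]].
have [[Pt [pt et]] [Pb [pb eb]] [Pn [pn en]]] := Decomp_parts hA ht hb hn hd.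
have [[Qt [qt ft]] [Qb [qb fb]] [Qn [qn fn]]] := Decomp_parts hA ht' hb' hn' hd'.
split; last split.
- exact: (pcard_uniq (j := Tp) isT) qt pt (eqp_trans ft (eqp_sym et)).
- exact: (pcard_uniq (j := Tp) isT) qb pb (eqp_trans fb (eqp_sym eb)).
- exact: (pcard_uniq (j := Tp) isT) qn pn (eqp_trans fn (eqp_sym en)).
Qed.

Lemma iT_decomposition_exists_unique s :
  istrue s (sentence
    (∀ k, cardinal k →
       ∃ t b n,
         (classical_cardinal t ∧ classical_cardinal b ∧ classical_cardinal n
            ∧ is_decomposition k t b n)
         ∧ (∀ t' b' n',
              classical_cardinal t' ∧ classical_cardinal b'
                ∧ classical_cardinal n' ∧ is_decomposition k t' b' n' →
              t' ≐ t ∧ b' ≐ b ∧ n' ≐ n))%bs4) <->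
  (forall k, (exists A, Card k A) ->
  exists t b n,
    (ClCardinal t /\ ClCardinal b /\ ClCardinal n /\ Decomp k t b n)
    /\ (forall t' b' n',
          ClCardinal t' /\ ClCardinal b' /\ ClCardinal n'
            /\ Decomp k t' b' n' -> t' = t /\ b' = b /\ n' = n)).
Proof. by rewrite /sentence /cardinal; sem. Qed.

End Semantics.

Theorem corollary5p10 :
  entails BZFC (sentence
    (∀ k, cardinal k →
       ∃ t b n,
         (classical_cardinal t ∧ classical_cardinal b ∧ classical_cardinal n
            ∧ is_decomposition k t b n)
         ∧ (∀ t' b' n',
              classical_cardinal t' ∧ classical_cardinal b'
                ∧ classical_cardinal n' ∧ is_decomposition k t' b' n' →
              t' ≐ t ∧ b' ≐ b ∧ n' ≐ n))%bs4).
Proof.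
move=> M MT s; apply/(iT_decomposition_exists_unique MT) => k.
exact: decomposition_exists_unique.
Qed.
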